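(* Let $\mathcal{T}$ be a nonzero triangulated category of finite type over a field admitting a split-generator, with $(\Lambda,v)$ as in the context, and let $\mathrm{Stab}_\Lambda^\dagger(\mathcal{T})$ be a connected component of $\mathrm{Stab}_\Lambda(\mathcal{T})$. For every pseudo-Anosov functor $F\in\mathrm{Aut}(\mathcal{T})$ one has $$h(F)\ \ge\ \bar{d_B}(F)\ >\ 0,$$ where $h(F)$ is the entropy of $F$ and $\bar{d_B}(F)$ is the translation length of $F$ acting on $(\mathrm{Stab}_\Lambda^\dagger(\mathcal{T})/\mathbb{C},\bar{d_B})$.
   Context: $\mathcal{T}$ is of finite type over a field $k$: $k$-linear with $\bigoplus_i\mathrm{Hom}(E,F[i])$ finite dimensional for all $E,F$. $\mathrm{Aut}(\mathcal{T})$ is the group of autoequivalences, $K(\mathcal{T})$ the Grothendieck group. Fixed: a finitely generated free abelian group $\Lambda$, a surjection $v:K(\mathcal{T})\to\Lambda$, a norm on $\Lambda\otimes\mathbb{R}$; it is assumed that there is a homomorphism $\alpha:\mathrm{Aut}(\mathcal{T})\to\mathrm{Aut}_{\mathbb{Z}}(\Lambda)$ with $v\circ K(F)=\alpha(F)\circ v$ for all $F$. Stability condition: a pair $\sigma=(Z,\mathcal{P})$ of a group homomorphism $Z:\Lambda\to\mathbb{C}$ and a family $\{\mathcal{P}(\phi)\}_{\phi\in\mathbb{R}}$ of full additive subcategories of $\mathcal{T}$ such that: (1) for $0\ne E\in\mathcal{P}(\phi)$, $Z(v(E))\in\mathbb{R}_{>0}e^{i\pi\phi}$; (2) $\mathcal{P}(\phi+1)=\mathcal{P}(\phi)[1]$;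 (3) $\mathrm{Hom}(E_1,E_2)=0$ for $E_i\in\mathcal{P}(\phi_i)$, $\phi_1>\phi_2$; (4) every $E\neq0$ has a Harder--Narasimhan filtration, i.e. exact triangles $E_{i-1}\to E_i\to A_i\to E_{i-1}[1]$, $i=1,\dots,p$, with $E_0=0$, $E_p=E$, $0\ne A_i\in\mathcal{P}(\phi_i)$, $\phi_1>\dots>\phi_p$; (5) (support property) there is $C>0$ with $\|v(E)\|<C|Z(v(E))|$ for all $0\ne E\in\mathcal{P}(\phi)$ and all $\phi$. Set $\phi^+_\sigma(E)=\phi_1$, $\phi^-_\sigma(E)=\phi_p$, $m_\sigma(E)=\sum_i|Z(v(A_i))|$. $\mathrm{Stab}_\Lambda(\mathcal{T})$ is the set of stability conditions, topologized by the generalized metric $$d_B(\sigma,\tau)=\sup_{E\neq0}\Big\{|\phi^+_\sigma(E)-\phi^+_\tau(E)|,\ |\phi^-_\sigma(E)-\phi^-_\tau(E)|,\ \Big|\log\tfrac{m_\sigma(E)}{m_\tau(E)}\Big|\Big\}\in[0,\infty],$$ finite on each connected component. Actions. $F.\sigma=(Z_\sigma\circ\alpha(F)^{-1},\{F(\mathcal{P}_\sigma(\phi))\})$ for $F\in\mathrm{Aut}(\mathcal{T})$. The universal cover $\varphi:\widetilde{\mathrm{GL}}_+(2,\mathbb{R})\to\mathrm{GL}_+(2,\mathbb{R})$ is identified with the group of pairs $(M,f)$, $M\in\mathrm{GL}_+(2,\mathbb{R})$ and $f:\mathbb{R}\to\mathbb{R}$ increasing with $f(\phi+1)=f(\phi)+1$,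 such that $M$ and $f$ induce the same map on $(\mathbb{R}^2\setminus\{0\})/\mathbb{R}_{>0}=S^1=\mathbb{R}/2\mathbb{Z}$ ($\phi\leftrightarrow e^{i\pi\phi}$, $\mathbb{C}=\mathbb{R}^2$); it acts on the right by $\sigma.(M,f)=(M^{-1}\circ Z_\sigma,\{\mathcal{P}_\sigma(f(\phi))\})$. The subgroup $\mathbb{C}$ acts by $\sigma.\lambda=(e^{-i\pi\lambda}Z_\sigma,\{\mathcal{P}_\sigma(\phi+\mathrm{Re}\,\lambda)\})$. The actions of $\mathrm{Aut}(\mathcal{T})$ and $\mathbb{C}$ are isometric and commute. On $\mathrm{Stab}_\Lambda^\dagger(\mathcal{T})/\mathbb{C}$ the quotient metric is $\bar{d_B}(\bar\sigma,\bar\tau)=\inf_{\lambda\in\mathbb{C}}d_B(\sigma,\tau.\lambda)$. $F\in\mathrm{Aut}(\mathcal{T})$ is pseudo-Anosov if there exist $\sigma_F\in\mathrm{Stab}_\Lambda^\dagger(\mathcal{T})$ and $g_F\in\widetilde{\mathrm{GL}}_+(2,\mathbb{R})$ such that $F.\sigma_F=\sigma_F.g_F$ and $\varphi(g_F)=\begin{pmatrix}1/r&0\\0&r\end{pmatrix}$ or $\begin{pmatrix}r&0\\0&1/r\end{pmatrix}$ for some real $r$ with $|r|>1$. Such $F$ preserves $\mathrm{Stab}_\Lambda^\dagger(\mathcal{T})$. Its translation length is $\bar{d_B}(F)=\inf_{\bar\sigma\in\mathrm{Stab}_\Lambda^\dagger(\mathcal{T})/\mathbb{C}}\bar{d_B}(\bar\sigma,F\bar\sigma)$.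 Entropy: for a split-generator $G$ of $\mathcal{T}$, $h(F)=\lim_{n\to\infty}\frac1n\log\delta(G,F^nG)$, where $\delta(G,F^nG)$ is the minimal $p\ge1$ for which there are an object $M$, integers $n_1,\dots,n_p$ and exact triangles $M_{i-1}\to M_i\to G[n_i]\to M_{i-1}[1]$ ($i=1,\dots,p$) with $M_0=0$, $M_p=F^nG\oplus M$. The limit exists and is independent of $G$. *)

(* Defs.v *)
(* Real numbers: an arbitrary [realType] of MathComp-Analysis; complex numbers:
   [R[i]] of mathcomp-real-closed. *)
From HB Require Import structures.
From mathcomp Require Import all_boot all_order all_algebra.
From mathcomp Require Import all_classical all_reals all_analysis.
From mathcomp.real_closed Require Import complex.
From mathcomp.multinomials Require Import freeg.
Set Implicit Arguments.
Unset Strict Implicit.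
Unset Printing Implicit Defensive.
Import Order.TTheory GRing.Theory Num.Theory.
Import numFieldNormedType.Exports.
Local Open Scope classical_set_scope.
Local Open Scope ring_scope.

Record lincat (k : fieldType) := LinCat {
  ob :> Type;
  hom : ob -> ob -> lmodType k;
  idm : forall X : ob, hom X X;
  cmp : forall X Y Z : ob, hom Y Z -> hom X Y -> hom X Z;
  cmp_assoc : forall (X Y Z W : ob) (h : hom Z W) (g : hom Y Z) (f : hom X Y),
    cmp h (cmp g f) = cmp (cmp h g) f;
  cmp_idl : forall (X Y : ob) (f : hom X Y), cmp (idm Y) f = f;
  cmp_idr : forall (X Y : ob) (f : hom X Y), cmp f (idm X) = f;
  cmp_linl : forall (X Y Z : ob) (a : k) (g g' : hom Y Z) (f : hom X Y),
    cmp (a *: g + g') f = a *: cmp g f + cmp g' f;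
  cmp_linr : forall (X Y Z : ob) (a : k) (g : hom Y Z) (f f' : hom X Y),
    cmp g (a *: f + f') = a *: cmp g f + cmp g f'
}.
Arguments idm {k l} X.
Arguments cmp {k l X Y Z} g f.
Notation "g \oc f" := (cmp g f) (at level 40, left associativity).

Section LinearCategories.
Variable k : fieldType.

Definition is_iso (C : lincat k) (X Y : C) (f : hom X Y) : Prop :=
  exists g : hom Y X, g \oc f = idm X /\ f \oc g = idm Y.

Definition isomorphic (C : lincat k) (X Y : C) : Prop :=
  exists f : hom X Y, is_iso f.

Definition is_zero (C : lincat k) (X : C) : Prop :=
  forall Y : C, (forall f : hom X Y, f = 0) /\ (forall f : hom Y X, f = 0).

(* S is a biproduct of X and Y *)
Definition is_dsum (C : lincat k) (X Y S : C) : Prop :=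
  exists (i1 : hom X S) (i2 : hom Y S) (p1 : hom S X) (p2 : hom S Y),
    [/\ p1 \oc i1 = idm X, p2 \oc i2 = idm Y, p1 \oc i2 = 0, p2 \oc i1 = 0
      & i1 \oc p1 + i2 \oc p2 = idm S].

Record functor (C D : lincat k) := Functor {
  fob :> C -> D;
  fmap : forall X Y : C, {linear hom X Y -> hom (fob X) (fob Y)};
  fmap_id : forall X : C, fmap X X (idm X) = idm (fob X);
  fmap_cmp : forall (X Y Z : C) (g : hom Y Z) (f : hom X Y),
    fmap X Z (g \oc f) = fmap Y Z g \oc fmap X Y f
}.

Definition natiso (C D : lincat k) (F G : functor C D) : Prop :=
  exists eta : forall X : C, hom (F X) (G X),
    (forall X, is_iso (eta X)) /\
    (forall (X Y : C) (f : hom X Y),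
       eta Y \oc fmap F X Y f = fmap G X Y f \oc eta X).

Definition id_functor (C : lincat k) : functor C C :=
  @Functor C C (fun X => X) (fun X Y => idfun)
    (fun X => erefl) (fun X Y Z g f => erefl).

Lemma comp_functor_id (C D E : lincat k) (G : functor D E) (F : functor C D)
  (X : C) : fmap G _ _ (fmap F X X (idm X)) = idm (G (F X)).
Proof. by rewrite !fmap_id. Qed.

Lemma comp_functor_cmp (C D E : lincat k) (G : functor D E) (F : functor C D)
  (X Y Z : C) (g : hom Y Z) (f : hom X Y) :
  fmap G _ _ (fmap F X Z (g \oc f)) =
  fmap G _ _ (fmap F Y Z g) \oc fmap G _ _ (fmap F X Y f).
Proof. by rewrite !fmap_cmp. Qed.

Definition comp_functor (C D E : lincat k) (G : functor D E) (F : functor C D) :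
    functor C E :=
  @Functor C E (fun X => G (F X))
    (fun X Y => fmap G (F X) (F Y) \o fmap F X Y)
    (comp_functor_id G F) (comp_functor_cmp G F).

Definition quasi_inverse (C D : lincat k) (F : functor C D) (G : functor D C) :
    Prop :=
  natiso (comp_functor G F) (id_functor C) /\
  natiso (comp_functor F G) (id_functor D).

End LinearCategories.

(* The shift is only required to be an autoequivalence with a chosen
   quasi-inverse, so that a strictly invertible shift is a special case. *)
Record tricat (k : fieldType) := TriCat {
  tcat :> lincat k;
  has_zero : exists X : tcat, is_zero X;
  has_dsum : forall X Y : tcat, exists S : tcat, is_dsum X Y S;
  shift : functor tcat tcat;
  unshift : functor tcat tcat;
  shift_unshift : quasi_inverse shift unshift;
  (* exact triangles X -> Y -> Z -> X[1] *)
  tri : forall X Y Z : tcat, hom X Y -> hom Y Z -> hom Z (shift X) -> Prop;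
  tri_iso : forall (X Y Z X' Y' Z' : tcat)
    (f : hom X Y) (g : hom Y Z) (h : hom Z (shift X))
    (f' : hom X' Y') (g' : hom Y' Z') (h' : hom Z' (shift X'))
    (a : hom X X') (b : hom Y Y') (c : hom Z Z'),
    is_iso a -> is_iso b -> is_iso c ->
    b \oc f = f' \oc a -> c \oc g = g' \oc b ->
    fmap shift _ _ a \oc h = h' \oc c ->
    tri f g h -> tri f' g' h';
  tri_id : forall X Z : tcat, is_zero Z ->
    tri (idm X) (0 : hom X Z) (0 : hom Z (shift X));
  tri_cone : forall (X Y : tcat) (f : hom X Y),
    exists (Z : tcat) (g : hom Y Z) (h : hom Z (shift X)), tri f g h;
  tri_rot : forall (X Y Z : tcat)
    (f : hom X Y) (g : hom Y Z) (h : hom Z (shift X)),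
    tri f g h <-> tri g h (- fmap shift _ _ f);
  tri_fill : forall (X Y Z X' Y' Z' : tcat)
    (f : hom X Y) (g : hom Y Z) (h : hom Z (shift X))
    (f' : hom X' Y') (g' : hom Y' Z') (h' : hom Z' (shift X'))
    (a : hom X X') (b : hom Y Y'),
    tri f g h -> tri f' g' h' -> b \oc f = f' \oc a ->
    exists c : hom Z Z',
      c \oc g = g' \oc b /\ fmap shift _ _ a \oc h = h' \oc c;
  tri_oct : forall (X Y Z Z' X' Y' : tcat) (f : hom X Y) (g : hom Y Z)
    (i : hom Y Z') (j : hom Z' (shift X))
    (p : hom Z X') (q : hom X' (shift Y))
    (m : hom Z Y') (n : hom Y' (shift X)),
    tri f i j -> tri g p q -> tri (g \oc f) m n ->
    exists (u : hom Z' Y') (w : hom Y' X'),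
      [/\ tri u w (fmap shift _ _ i \oc q),
          u \oc i = m \oc g, n \oc u = j, w \oc m = p
        & fmap shift _ _ f \oc n = q \oc w]
}.
Arguments shift {k} t.
Arguments unshift {k} t.
Arguments tri {k t X Y Z} f g h.

Definition shiftz (k : fieldType) (T : tricat k) (n : int) (X : T) : T :=
  match n with
  | Posz m => iter m (shift T) X
  | Negz m => iter m.+1 (unshift T) X
  end.

(* [\bigoplus_i Hom(E, F[i])] is finite dimensional: every summand is, and all
   but finitely many vanish. *)
Definition finite_type (k : fieldType) (T : tricat k) : Prop :=
  forall E F : T,
    (forall i : int, exists (n : nat) (b : 'I_n -> hom E (shiftz i F)),
       forall f : hom E (shiftz i F),
       exists c : 'I_n -> k, f = \sum_(j < n) c j *: b j) /\
    (exists N : nat, forall i : int, (N < `|i|)%N ->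
       forall f : hom E (shiftz i F), f = 0).

Definition nonzero_cat (k : fieldType) (T : tricat k) : Prop :=
  exists E : T, ~ is_zero E.

(* Thick subcategories: strictly full triangulated subcategories closed under
   direct summands. *)
Record thick (k : fieldType) (T : tricat k) (P : set T) : Prop := Thick {
  thick_iso : forall X Y : T, isomorphic X Y -> P X -> P Y;
  thick_zero : forall X : T, is_zero X -> P X;
  thick_shift : forall X : T, P X -> P (shift T X);
  thick_unshift : forall X : T, P X -> P (unshift T X);
  thick_cone : forall (X Y Z : T)
    (f : hom X Y) (g : hom Y Z) (h : hom Z (shift T X)),
    tri f g h -> P X -> P Y -> P Z;
  thick_summand : forall X Y S : T, is_dsum X Y S -> P S -> P X
}.

Definition split_generator (k : fieldType) (T : tricat k) (G : T) : Prop :=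
  forall P : set T, thick P -> P G -> forall E : T, P E.

Definition exact_functor (k : fieldType) (T : tricat k) (F : functor T T) :
    Prop :=
  exists theta : forall X : T, hom (F (shift T X)) (shift T (F X)),
    [/\ forall X, is_iso (theta X),
        forall (X Y : T) (f : hom X Y),
          theta Y \oc fmap F _ _ (fmap (shift T) _ _ f) =
          fmap (shift T) _ _ (fmap F _ _ f) \oc theta X
      & forall (X Y Z : T) (f : hom X Y) (g : hom Y Z) (h : hom Z (shift T X)),
          tri f g h ->
          tri (fmap F _ _ f) (fmap F _ _ g) (theta X \oc fmap F _ _ h)].

Record autoeq (k : fieldType) (T : tricat k) := AutoEq {
  aeq_fun :> functor T T;
  aeq_exact : exact_functor aeq_fun;
  aeq_equiv : exists G : functor T T, quasi_inverse aeq_fun G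
}.

Section Grothendieck.
Variables (k : fieldType) (T : tricat k).

Local Notation FG := {freeg {classic T}}.

Definition fgen (E : T) : FG := << (E : {classic T}) >>.

(* The subgroup generated by the [Y] - [X] - [Z], X -> Y -> Z -> X[1] exact. *)
Definition tri_rel : {pred FG} := fun x => `[<
  forall S : set FG, S 0 -> (forall a b, S a -> S b -> S (a - b)) ->
  (forall (X Y Z : T) (f : hom X Y) (g : hom Y Z) (h : hom Z (shift T X)),
     tri f g h -> S (fgen Y - fgen X - fgen Z)) ->
  S x >].

Lemma tri_rel_zmod_closed : zmod_closed tri_rel.
Proof.
split=> [|a b /asboolP Sa /asboolP Sb]; apply/asboolP => S S0 SB Str //.
exact: SB (Sa S S0 SB Str) (Sb S S0 SB Str).
Qed.

HB.instance Definition _ := GRing.isZmodClosed.Build FG tri_rel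
  tri_rel_zmod_closed.

Definition K0 : zmodType := ring_quotient.Quotient.quot tri_rel.

Definition cls (E : T) : K0 :=
  \pi_(ring_quotient.Quotient.quot tri_rel)%qT (fgen E).

End Grothendieck.

(* A free abelian group of finite rank [lrank] with a surjection
   [lv : K(T) -> lat]. A choice of coordinates [lcoord] (that is, of a basis)
   identifies [lat \otimes R] with ['rV[R]_lrank]; [lnorm] is an arbitrary norm
   on the latter. *)
Record lattice (R : realType) (k : fieldType) (T : tricat k) := Lattice {
  lat :> zmodType;
  lrank : nat;
  lcoord : {additive lat -> 'rV[int]_lrank};
  lcoord_bij : bijective lcoord;
  lv : {additive K0 T -> lat};
  lv_surj : forall x : lat, exists y : K0 T, lv y = x;
  lnorm : 'rV[R]_lrank -> R;
  lnorm_eq0 : forall x, lnorm x = 0 -> x = 0;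
  lnormD : forall x y, lnorm (x + y) <= lnorm x + lnorm y;
  lnormZ : forall (a : R) x, lnorm (a *: x) = `|a| * lnorm x
}.
Arguments lv {R k T} l.

Record zaut (L : zmodType) := ZAut {
  zaut_fun :> {additive L -> L};
  zaut_inv : {additive L -> L};
  zaut_funK : cancel zaut_fun zaut_inv;
  zaut_invK : cancel zaut_inv zaut_fun
}.

Section Stability.
Variables (R : realType) (k : fieldType) (T : tricat k) (L : lattice R T).

Definition vcl (E : T) : L := lv L (cls E).

(* the norm of [x \otimes 1] *)
Definition lat_norm (x : L) : R := lnorm (map_mx intr (lcoord L x)).

Definition absC (z : R[i]) : R := ComplexField.Normc.normc z.

Definition expC (z : R[i]) : R[i] :=
  Complex (expR (complex.Re z) * cos (complex.Im z))
          (expR (complex.Re z) * sin (complex.Im z)).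

(* e^{i pi phi} *)
Definition unit_phase (phi : R) : R[i] := expC (Complex 0 (pi * phi)).

(* Pairs (Z, P), without the axioms; the P(phi) are full subcategories, hence
   given by their objects. *)
Record stab_data := StabData {
  charge : L -> R[i];
  slice : R -> set T
}.

(* [X] is the sequence of objects E_0 = 0, ..., E_p = E *)
Definition tower (E : T) (p : nat) (A : nat -> T) : Prop :=
  exists X : nat -> T, [/\ is_zero (X 0%N), X p = E &
    forall i, (i < p)%N ->
    exists (f : hom (X i) (X i.+1)) (g : hom (X i.+1) (A i))
           (h : hom (A i) (shift T (X i))), tri f g h].

(* Indices run over 0, ..., p - 1 instead of 1, ..., p. *)
Definition HN_filtration (s : stab_data) (E : T)
    (p : nat) (A : nat -> T) (phi : nat -> R) : Prop :=
  [/\ (0 < p)%N, tower E p A,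
      forall i, (i < p)%N -> ~ is_zero (A i) /\ slice s (phi i) (A i)
    & forall i, (i.+1 < p)%N -> phi i.+1 < phi i].

(* Subcategories are closed under isomorphism, so that P(phi)[1] and F(P(phi))
   are understood as essential images. *)
Record additive_subcat (P : set T) : Prop := AdditiveSubcat {
  addsub_iso : forall X Y : T, isomorphic X Y -> P X -> P Y;
  addsub_zero : forall X : T, is_zero X -> P X;
  addsub_dsum : forall X Y S : T, is_dsum X Y S -> P X -> P Y -> P S
}.

Definition image_subcat (F : functor T T) (P : set T) : set T :=
  [set E | exists2 E', P E' & isomorphic E (F E')].

Record is_stability (s : stab_data) : Prop := IsStability {
  stab_chargeB : forall x y : L, charge s (x - y) = charge s x - charge s y;
  stab_slice : forall phi, additive_subcat (slice s phi);
  stab_phase : forall phi E, slice s phi E -> ~ is_zero E ->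
    exists2 m : R, 0 < m & charge s (vcl E) = m%:C%C * unit_phase phi;
  stab_shift : forall phi,
    slice s (phi + 1) = image_subcat (shift T) (slice s phi);
  stab_hom : forall phi1 phi2 E1 E2, phi2 < phi1 ->
    slice s phi1 E1 -> slice s phi2 E2 -> forall f : hom E1 E2, f = 0;
  stab_HN : forall E, ~ is_zero E -> exists p A phi, HN_filtration s E p A phi;
  stab_support : exists2 C : R, 0 < C & forall phi E, slice s phi E ->
    ~ is_zero E -> lat_norm (vcl E) < C * absC (charge s (vcl E))
}.

Record stab := Stab { stab_val :> stab_data; stabP : is_stability stab_val }.

(* Harder-Narasimhan filtrations are unique up to isomorphism, so for
   [is_stability s] and E <> 0 the values below are uniquely determined. *)
Definition phi_plus (s : stab_data) (E : T) : R :=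
  xget 0 [set x | exists p A phi,
    HN_filtration s E p A phi /\ x = phi 0%N].

Definition phi_minus (s : stab_data) (E : T) : R :=
  xget 0 [set x | exists p A phi,
    HN_filtration s E p A phi /\ x = phi p.-1].

Definition mass (s : stab_data) (E : T) : R :=
  xget 0 [set x | exists p A phi,
    HN_filtration s E p A phi /\
    x = \sum_(i < p) absC (charge s (vcl (A i)))].

Definition dB (s t : stab_data) : \bar R :=
  ereal_sup [set x | exists2 E : T, ~ is_zero E &
    [\/ x = `|phi_plus s E - phi_plus t E|%:E,
        x = `|phi_minus s E - phi_minus t E|%:E
      | x = `|ln (mass s E / mass t E)|%:E]].

Definition dB_open (U : set stab) : Prop :=
  forall s, U s -> exists2 e : R, 0 < e &
    forall t : stab, (dB s t < e%:E)%E -> U t.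

Lemma dB_openT : dB_open setT.
Proof. by move=> s _; exists 1. Qed.

Lemma dB_openI : setI_closed dB_open.
Proof.
move=> U V oU oV s [/oU[e e0 eU] /oV[d d0 dV]].
exists (Num.min e d); first by rewrite lt_min e0.
move=> t; rewrite EFin_min lt_min => /andP[te td].
by split; [exact: eU | exact: dV].
Qed.

Lemma dB_open_bigU (I : Type) (f : I -> set stab) :
  (forall i, dB_open (f i)) -> dB_open (\bigcup_i f i).
Proof.
move=> of_ s [i _ /of_[e e0 ef]]; exists e => // t /ef ft.
by exists i.
Qed.

HB.instance Definition _ := gen_eqMixin stab.
HB.instance Definition _ := gen_choiceMixin stab.
HB.instance Definition _ :=
  isOpenTopological.Build stab dB_openT dB_openI dB_open_bigU.

Definition is_component (S : set stab) : Prop :=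
  exists s : stab, S = connected_component setT s.

(* alpha is a homomorphism on the group of autoequivalences up to natural
   isomorphism, and v o K(F) = alpha(F) o v; the latter is stated on the classes
   of objects, which generate K(T), using K(F)[E] = [F E]. *)
Record lattice_action (alpha : autoeq T -> zaut L) : Prop := LatticeAction {
  lact_comp : forall F G H : autoeq T, natiso H (comp_functor F G) ->
    forall x : L, alpha H x = alpha F (alpha G x);
  lact_class : forall (F : autoeq T) (E : T), vcl (F E) = alpha F (vcl E)
}.

Definition aut_act (alpha : autoeq T -> zaut L) (F : autoeq T)
    (s : stab_data) : stab_data :=
  StabData (fun x => charge s (zaut_inv (alpha F) x))
           (fun phi => image_subcat F (slice s phi)).

Definition mxC (M : 'M[R]_2) (z : R[i]) : R[i] :=
  Complex (M 0 0 * complex.Re z + M 0 1 * complex.Im z)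
          (M 1 0 * complex.Re z + M 1 1 * complex.Im z).

(* the universal cover of GL_+(2, R) *)
Record gl2tilde := GL2tilde {
  gl_mx : 'M[R]_2;
  gl_fun : R -> R;
  gl_det : 0 < \det gl_mx;
  gl_incr : {homo gl_fun : x y / x < y};
  gl_shift : forall phi, gl_fun (phi + 1) = gl_fun phi + 1;
  gl_compat : forall phi, exists2 c : R, 0 < c &
    mxC gl_mx (unit_phase phi) = c%:C%C * unit_phase (gl_fun phi)
}.

Definition gl_act (s : stab_data) (g : gl2tilde) : stab_data :=
  StabData (fun x => mxC (invmx (gl_mx g)) (charge s x))
           (fun phi => slice s (gl_fun g phi)).

Definition C_act (s : stab_data) (l : R[i]) : stab_data :=
  StabData (fun x => expC (- ('i%C * pi%:C%C * l)) * charge s x)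
           (fun phi => slice s (phi + complex.Re l)).

(* quotient metric between the C-orbits of s and t *)
Definition dB_bar (s t : stab_data) : \bar R :=
  ereal_inf [set dB s (C_act t l) | l in [set: R[i]]].

(* Infimum over the points of S / C, written over their representatives. *)
Definition translation_length (S : set stab) (alpha : autoeq T -> zaut L)
    (F : autoeq T) : \bar R :=
  ereal_inf [set dB_bar s (aut_act alpha F s) | s in S].

Definition diag2 (a b : R) : 'M[R]_2 :=
  \matrix_(i, j) (if i == j then if i == 0 then a else b else 0).

Definition pseudo_Anosov (S : set stab) (alpha : autoeq T -> zaut L)
    (F : autoeq T) : Prop :=
  exists (s : stab) (g : gl2tilde) (r : R),
    [/\ S s, aut_act alpha F s = gl_act s g, 1 < `|r|
      & gl_mx g = diag2 r^-1 r \/ gl_mx g = diag2 r r^-1].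

End Stability.

Section Entropy.
Variables (R : realType) (k : fieldType) (T : tricat k).

(* a tower for E (+) M with p factors, all shifts of G *)
Definition G_tower (G E : T) (p : nat) : Prop :=
  exists (M S : T) (n : nat -> int),
    is_dsum E M S /\ tower S p (fun i => shiftz (n i) G).

(* The minimal p >= 1 with [G_tower G E p]; it exists for a split-generator G. *)
Definition complexity (G E : T) : nat :=
  xget 0%N [set p | [/\ (1 <= p)%N, G_tower G E p &
    forall q, (1 <= q)%N -> G_tower G E q -> (p <= q)%N]].

Definition entropy (G : T) (F : autoeq T) : R :=
  limn (fun n : nat =>
    n%:R^-1 * ln ((complexity G (iter n F G))%:R : R)).

End Entropy.

(* Main.v *)
(** Write [Z = (x, y)] in the eigendirections of the hyperbolic matrix of [F],
    let [rho = |r|] and let [c] be the coordinate that [F] expands. The number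
    [ln rho] separates the two sides.

    Upper bound for the translation length. After an integral shift, the lift
    [f] of the matrix to the line fixes the integers and the half-integers, and
    it moves a phase by at most [ln rho]; masses change by a factor in
    [[1/rho, rho]]. So [d(s, (F s).l) <= ln rho] for an integer [l].

    Lower bound for the entropy. For the heart [P(t, t+1]] of a suitable [t], the
    function [|c o Z|] is additive and nonnegative, so its value on the degree
    zero cohomology is subadditive on triangles, monotone under direct summands,
    and bounded on a semistable object [B] by [|c(Z(B))|]. Hence a tower of [p]
    shifts of [G] with [F^n G] as a direct summand has
    [p * const >= |c(Z(F^n A))| = rho^n |c(Z(A))|], [A] being the first
    Harder-Narasimhan factor of [G]. Here [c(Z(A)) <> 0]: otherwise [Z(F^n A)]
    tends to [0], whereas the support property bounds [|Z|] below on semistable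
    objects.

    Positivity. By the same argument the masses of [F^n A] and of [F^-n A] both
    grow like [rho^n], for [s] and then for every [t] in the component, where
    masses are comparable. If [d(t, (F t).l) <= d], then each application of [F]
    multiplies masses for [t] by a factor in [[e^-d C, e^d C]], [C] depending
    on [l]; the growth in both directions gives [2 ln rho <= 2 d]. *)
From HB Require Import structures.
From mathcomp Require Import all_boot all_order all_algebra.
From mathcomp Require Import all_classical all_reals all_analysis.
From mathcomp.real_closed Require Import complex.
From mathcomp.multinomials Require Import freeg.
From mathcomp Require Import ring lra.
Require Import Defs.
Set Implicit Arguments.
Unset Strict Implicit.
Unset Printing Implicit Defensive.
Import Order.TTheory GRing.Theory Num.Theory.
Import numFieldNormedType.Exports.
Local Open Scope ring_scope.

(** * Linear and triangulated categories *)

Section LinearCategories.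
Variables (k : fieldType) (C : lincat k).
Implicit Types X Y Z W : C.

Lemma cmpDl X Y Z (g g' : hom Y Z) (f : hom X Y) :
  (g + g') \oc f = g \oc f + g' \oc f.
Proof. by have := cmp_linl 1 g g' f; rewrite !scale1r. Qed.

Lemma cmpDr X Y Z (g : hom Y Z) (f f' : hom X Y) :
  g \oc (f + f') = g \oc f + g \oc f'.
Proof. by have := cmp_linr 1 g f f'; rewrite !scale1r. Qed.

Lemma cmp0l X Y Z (f : hom X Y) : (0 : hom Y Z) \oc f = 0.
Proof. by apply: (addrI ((0 : hom Y Z) \oc f)); rewrite -cmpDl !addr0. Qed.

Lemma cmp0r X Y Z (g : hom Y Z) : g \oc (0 : hom X Y) = 0.
Proof. by apply: (addrI (g \oc (0 : hom X Y))); rewrite -cmpDr !addr0. Qed.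

Lemma cmpNl X Y Z (g : hom Y Z) (f : hom X Y) : (- g) \oc f = - (g \oc f).
Proof. by apply: (addrI (g \oc f)); rewrite -cmpDl !subrr cmp0l. Qed.

Lemma cmpNr X Y Z (g : hom Y Z) (f : hom X Y) : g \oc (- f) = - (g \oc f).
Proof. by apply: (addrI (g \oc f)); rewrite -cmpDr !subrr cmp0r. Qed.

Lemma cmpBl X Y Z (g g' : hom Y Z) (f : hom X Y) :
  (g - g') \oc f = g \oc f - g' \oc f.
Proof. by rewrite cmpDl cmpNl. Qed.

Lemma cmpBr X Y Z (g : hom Y Z) (f f' : hom X Y) :
  g \oc (f - f') = g \oc f - g \oc f'.
Proof. by rewrite cmpDr cmpNr. Qed.

Lemma is_zeroP X : is_zero X <-> idm X = 0.
Proof.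
split=> [zX|X0 Y]; first exact: (zX X).1.
by split=> f; [rewrite -(cmp_idr f)|rewrite -(cmp_idl f)]; rewrite X0 ?cmp0r ?cmp0l.
Qed.

Definition retract X Y : Prop :=
  exists (i : hom X Y) (q : hom Y X), q \oc i = idm X.

Lemma iso_refl X : isomorphic X X.
Proof. by exists (idm X), (idm X); rewrite !cmp_idl. Qed.

Lemma iso_sym X Y : isomorphic X Y -> isomorphic Y X.
Proof. by move=> [f [g [gf fg]]]; exists g, f. Qed.

Lemma is_iso_cmp X Y Z (g : hom Y Z) (f : hom X Y) :
  is_iso g -> is_iso f -> is_iso (g \oc f).
Proof.
move=> [g' [g'g gg']] [f' [f'f ff']]; exists (f' \oc g'); split.
  by rewrite cmp_assoc -(cmp_assoc f') g'g cmp_idr.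
by rewrite cmp_assoc -(cmp_assoc g) ff' cmp_idr.
Qed.

Lemma iso_trans X Y Z : isomorphic X Y -> isomorphic Y Z -> isomorphic X Z.
Proof. by move=> [f fi] [g gi]; exists (g \oc f); apply: is_iso_cmp. Qed.

Lemma iso_retract X Y : isomorphic X Y -> retract X Y.
Proof. by move=> [f [g [gf fg]]]; exists f, g. Qed.

Lemma retract_trans X Y Z : retract X Y -> retract Y Z -> retract X Z.
Proof.
move=> [i [q qi]] [j [p pj]]; exists (j \oc i), (q \oc p).
by rewrite cmp_assoc -(cmp_assoc q) pj cmp_idr.
Qed.

Lemma retract_zero X Y : retract X Y -> is_zero Y -> is_zero X.
Proof.
move=> [i [q qi]] zY; apply/is_zeroP.
by rewrite -qi ((zY X).1 q) cmp0l.
Qed.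

Lemma iso_zero X Y : isomorphic X Y -> is_zero X -> is_zero Y.
Proof. by move=> /iso_sym/iso_retract r; apply: retract_zero r. Qed.

Lemma dsum_retract X Y S : is_dsum X Y S -> retract X S.
Proof. by move=> [i1 [i2 [p1 [p2 [? _ _ _ _]]]]]; exists i1, p1. Qed.

Lemma dsum_sym X Y S : is_dsum X Y S -> is_dsum Y X S.
Proof.
move=> [i1 [i2 [p1 [p2 [? ? ? ? ?]]]]]; exists i2, i1, p2, p1.
by split=> //; rewrite addrC.
Qed.

End LinearCategories.

(** * Functors and equivalences *)

Section Functors.
Variables (k : fieldType).
Implicit Types C D : lincat k.

Lemma fmap_is_iso C D (F : functor C D) (X Y : C) (f : hom X Y) :
  is_iso f -> is_iso (fmap F _ _ f).
Proof.
by move=> [g [gf fg]]; exists (fmap F _ _ g); rewrite -!fmap_cmp gf fg !fmap_id.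
Qed.

Lemma fmap_iso C D (F : functor C D) (X Y : C) :
  isomorphic X Y -> isomorphic (F X) (F Y).
Proof. by move=> [f fi]; exists (fmap F _ _ f); apply: fmap_is_iso. Qed.

Lemma fmap_retract C D (F : functor C D) (X Y : C) :
  retract X Y -> retract (F X) (F Y).
Proof.
move=> [i [q qi]]; exists (fmap F _ _ i), (fmap F _ _ q).
by rewrite -fmap_cmp qi fmap_id.
Qed.

Lemma fmap_zero C D (F : functor C D) (X : C) : is_zero X -> is_zero (F X).
Proof. by move=> /is_zeroP X0; apply/is_zeroP; rewrite -fmap_id X0 linear0. Qed.

(** Conjugation by the natural isomorphism recovers [f] from [G (F f)]. *)
Lemma faithful_of_qinv C D (F : functor C D) (G : functor D C) :
  natiso (comp_functor G F) (id_functor C) ->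
  forall (X Y : C) (f g : hom X Y), fmap F _ _ f = fmap F _ _ g -> f = g.
Proof.
move=> [eta [etai nat]] X Y f g fg.
have [e [e1 e2]] := etai X.
rewrite -(cmp_idr f) -(cmp_idr g) -e2 !cmp_assoc.
by rewrite -[f]/(fmap (id_functor C) _ _ f) -[g]/(fmap (id_functor C) _ _ g)
  -!nat /= fg.
Qed.

(** The preimage is [G h] conjugated by the natural isomorphism [eta]; since [G] is faithful, it
    suffices to compare after applying [G]. *)
Lemma full_of_qinv C D (F : functor C D) (G : functor D C) :
  quasi_inverse F G ->
  forall (X Y : C) (h : hom (F X) (F Y)), exists f : hom X Y, fmap F _ _ f = h.
Proof.
move=> [GF FG] X Y h; have [eta [etai nat]] := GF.
have [e [e1 e2]] := etai X.
exists (eta Y \oc fmap G _ _ h \oc e).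
apply: (faithful_of_qinv FG).
have [e' [e'1 e'2]] := etai Y.
have := nat _ _ (eta Y \oc fmap G _ _ h \oc e).
rewrite /= -[RHS]cmp_assoc e1 cmp_idr => /(congr1 (cmp e')).
by rewrite !cmp_assoc e'1 !cmp_idl.
Qed.

Lemma qinv_iso C D (F : functor C D) (G : functor D C) :
  quasi_inverse F G ->
  (forall X, isomorphic (G (F X)) X) /\ (forall Y, isomorphic (F (G Y)) Y).
Proof.
move=> [[e1 [i1 _]] [e2 [i2 _]]].
by split=> X; [exists (e1 X); apply: i1|exists (e2 X); apply: i2].
Qed.

End Functors.

(** * Exact sequences, extensions and splittings from the triangulated axioms *)

Section Triangles.
Variables (k : fieldType) (T : tricat k).
Implicit Types X Y Z W A B E : T.
Local Notation sh f := (fmap (shift T) _ _ f).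

Lemma shift_faithful X Y (f g : hom X Y) : sh f = sh g -> f = g.
Proof. exact: (faithful_of_qinv (proj1 (shift_unshift T))). Qed.

Lemma shift_full X Y (h : hom (shift T X) (shift T Y)) :
  exists f : hom X Y, sh f = h.
Proof. exact: (full_of_qinv (shift_unshift T)). Qed.

Lemma unshiftK X : isomorphic (shift T (unshift T X)) X.
Proof. exact: (qinv_iso (shift_unshift T)).2. Qed.

Lemma shiftK X : isomorphic (unshift T (shift T X)) X.
Proof. exact: (qinv_iso (shift_unshift T)).1. Qed.

Lemma shift_inj_iso X Y : isomorphic (shift T X) (shift T Y) -> isomorphic X Y.
Proof.
move=> /(fmap_iso (unshift T)) XY.
exact: iso_trans (iso_trans (iso_sym (shiftK X)) XY) (shiftK Y).
Qed.

Lemma shift_zero X : is_zero (shift T X) -> is_zero X.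
Proof. by move/(fmap_zero (unshift T)); apply: iso_zero; apply: shiftK. Qed.

Lemma tri_cmp0 X Y Z (f : hom X Y) (g : hom Y Z) (h : hom Z (shift T X)) :
  tri f g h -> g \oc f = 0.
Proof.
move=> t; have [N zN] := has_zero T.
have [|c [cg _]] := @tri_fill _ _ _ _ _ _ _ _ _ _ _ _ _ _ (idm X) f
  (@tri_id _ T X N zN) t; first by [].
by rewrite -cg cmp0r.
Qed.

(** Exactness of Hom(W, -): the rotation of [W -> W -> 0] is mapped to the rotation of the given
    triangle, and the third component, desuspended, is the lift. *)
Lemma tri_exact_cov X Y Z (f : hom X Y) (g : hom Y Z) (h : hom Z (shift T X))
    W (u : hom W Y) :
  tri f g h -> g \oc u = 0 -> exists v : hom W X, u = f \oc v.
Proof.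
move=> t gu; have [N zN] := has_zero T.
have t1 := (tri_rot _ _ _).1 (@tri_id _ T W N zN).
have t2 := (tri_rot _ _ _).1 t.
have [|c [_]] := @tri_fill _ _ _ _ _ _ _ _ _ _ _ _ _ _ u 0 t1 t2.
  by rewrite cmp0l gu.
rewrite fmap_id cmpNr cmp_idr cmpNl => /oppr_inj e.
have [v cv] := shift_full c; exists v.
by apply: shift_faithful; rewrite fmap_cmp cv.
Qed.

Lemma tri_exact_contra X Y Z (f : hom X Y) (g : hom Y Z)
    (h : hom Z (shift T X)) W (u : hom Y W) :
  tri f g h -> u \oc f = 0 -> exists v : hom Z W, u = v \oc g.
Proof.
move=> t uf; have [N zN] := has_zero T.
have t1 : tri (0 : hom N W) (idm W) (0 : hom W (shift T N)).
  apply/tri_rot; rewrite linear0 oppr0.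
  by apply: tri_id; apply: fmap_zero.
have [|c [e _]] := @tri_fill _ _ _ _ _ _ _ _ _ _ _ _ _ _ (0 : hom X N) u t t1.
  by rewrite uf cmp0l.
by exists c; rewrite e cmp_idl.
Qed.

(** A triangle with its maps forgotten. Most arguments below only rearrange triangles, and this form
    keeps them up to isomorphism. *)
Definition ext A E B : Prop :=
  exists (f : hom A E) (g : hom E B) (h : hom B (shift T A)), tri f g h.

Lemma ext_iso A E B A' E' B' : isomorphic A A' -> isomorphic E E' ->
  isomorphic B B' -> ext A E B -> ext A' E' B'.
Proof.
move=> [a [a' [a1 a2]]] [b [b' [b1 b2]]] [c [c' [c1 c2]]] [f [g [h t]]].
exists (b \oc f \oc a'), (c \oc g \oc b'), (sh a \oc h \oc c').
apply: (@tri_iso _ _ _ _ _ _ _ _ f g h _ _ _ a b c _ _ _ _ _ _ t).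
- by exists a'.
- by exists b'.
- by exists c'.
- by rewrite -cmp_assoc a1 cmp_idr.
- by rewrite -cmp_assoc b1 cmp_idr.
- by rewrite -cmp_assoc c1 cmp_idr.
Qed.

Lemma ext_isom E' A E B : isomorphic E E' -> ext A E B -> ext A E' B.
Proof. by move=> i; apply: ext_iso => //; apply: iso_refl. Qed.

Lemma ext_isor B' A E B : isomorphic B B' -> ext A E B -> ext A E B'.
Proof. by move=> i; apply: ext_iso => //; apply: iso_refl. Qed.

Lemma ext_isol A' A E B : isomorphic A A' -> ext A E B -> ext A' E B.
Proof. by move=> i; apply: ext_iso => //; apply: iso_refl. Qed.

Lemma ext_rot A E B : ext A E B -> ext E B (shift T A).
Proof. by move=> [f [g [h /tri_rot t]]]; exists g, h, (- sh f). Qed.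

Lemma ext_rotV A E B : ext E B (shift T A) -> ext A E B.
Proof.
move=> [g [h [k0 t]]]; have [f0 ef] := shift_full k0.
by exists (- f0), g, h; apply/tri_rot; rewrite linearN opprK ef.
Qed.

Lemma ext_rot_unshift A E B : ext A E B -> ext (unshift T B) A E.
Proof. by move=> e; apply: ext_rotV; apply: ext_isor e; apply/iso_sym/unshiftK. Qed.

Lemma ext_shift A E B : ext A E B -> ext (shift T A) (shift T E) (shift T B).
Proof. by move=> /ext_rot/ext_rot/ext_rot. Qed.

Lemma ext_unshift A E B :
  ext A E B -> ext (unshift T A) (unshift T E) (unshift T B).
Proof. by move=> /ext_rot_unshift/ext_rot_unshift/ext_rot_unshift. Qed.

Lemma ext_exact (F : functor T T) A E B : exact_functor F ->
  ext A E B -> ext (F A) (F E) (F B).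
Proof.
move=> [th [_ _ F_tri]] [f [g [h /F_tri t]]].
by exists (fmap F _ _ f), (fmap F _ _ g), (th A \oc fmap F _ _ h).
Qed.

Lemma ext0r A B : is_zero B -> ext A A B.
Proof. by move=> zB; exists (idm A), 0, 0; apply: tri_id. Qed.

Lemma ext0l A B : is_zero A -> ext A B B.
Proof. by move=> zA; apply/ext_rotV/ext0r/fmap_zero. Qed.

(** The octahedral axiom, read as associativity of extensions: (A by B) by C is regrouped as A by (B
    by C). *)
Lemma ext_assoc A X B E C : ext A X B -> ext X E C ->
  exists2 Y, ext B Y C & ext A E Y.
Proof.
move=> [f [i [j t1]]] [g [p [q t2]]].
have [Y [m [n t3]]] := tri_cone (g \oc f).
have [u [w [t4 _ _ _ _]]] := tri_oct t1 t2 t3.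
by exists Y; [exists u, w, (sh i \oc q)|exists (g \oc f), m, n].
Qed.

(** The other direction of associativity is the octahedral axiom for the rotated triangles, shifted
    back. *)
Lemma ext_assocV A E Y B C : ext A E Y -> ext B Y C ->
  exists2 X, ext A X B & ext X E C.
Proof.
move=> /ext_rot e1 /ext_rot e2.
have [V e3 e4] := ext_assoc e1 e2.
exists (unshift T V); last exact: ext_rot_unshift.
apply/ext_rotV/ext_rotV/ext_rotV.
by apply: ext_isom e3; apply/iso_sym/unshiftK.
Qed.

Lemma ext_zero_iso A E B : ext A E B -> is_zero B -> isomorphic A E.
Proof.
move=> [f [g [h t]]] zB; exists f.
have [v idv] : exists v, idm E = f \oc v.
  by apply: tri_exact_cov t _; apply: (zB _).2.
exists v; split=> //.
apply: shift_faithful; rewrite fmap_id fmap_cmp.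
have [w idw] : exists w, idm (shift T A) = w \oc sh f.
  have [|w ew] := tri_exact_contra (u := idm (shift T A))
    ((tri_rot _ _ _).1 ((tri_rot _ _ _).1 t)).
    by rewrite cmp_idl; apply: (zB _).1.
  by exists (- w); rewrite ew cmpNr cmpNl.
suff -> : sh v = w by [].
by rewrite -[sh v]cmp_idl idw -cmp_assoc -fmap_cmp -idv fmap_id cmp_idr.
Qed.

Lemma ext_zero_iso_r A E B : ext A E B -> is_zero A -> isomorphic E B.
Proof.
move=> e zA; apply: ext_zero_iso (ext_rot e) _; exact: fmap_zero.
Qed.

Lemma split_tri_dsum X Y Z (f : hom X Y) (g : hom Y Z) :
  tri f g (0 : hom Z (shift T X)) -> is_dsum X Z Y.
Proof.
move=> t.
have [|s gs] := tri_exact_cov (u := idm Z) ((tri_rot _ _ _).1 t).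
  by rewrite cmp0l.
have [|q fq] := tri_exact_cov (u := idm Y - s \oc g) t.
  by rewrite cmpBr cmp_idr cmp_assoc -gs cmp_idl subrr.
(* The shift of [u] factors through the zero map [Z -> X[1]]. *)
have f_mono W (u : hom W X) : f \oc u = 0 -> u = 0.
  move=> fu; apply: shift_faithful; rewrite linear0.
  have t3 := (tri_rot _ _ _).1 ((tri_rot _ _ _).1 t).
  have [|v ->] := tri_exact_cov (u := sh u) t3; last by rewrite cmp0l.
  by rewrite cmpNl -fmap_cmp fu linear0 oppr0.
exists f, s, q, g; split=> //.
- apply/eqP; rewrite -subr_eq0; apply/eqP/f_mono.
  rewrite cmpBr cmp_idr cmp_assoc -fq cmpBl cmp_idl -cmp_assoc (tri_cmp0 t).
  by rewrite cmp0r subr0 subrr.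
- apply: f_mono; rewrite cmp_assoc -fq cmpBl cmp_idl -cmp_assoc -gs cmp_idr.
  by rewrite subrr.
- exact: tri_cmp0 t.
- by rewrite -fq subrK.
Qed.

Lemma split_mono_tri X Y Z (f : hom X Y) (g : hom Y Z) (h : hom Z (shift T X)) q :
  q \oc f = idm X -> tri f g h -> h = 0.
Proof.
move=> qf t; have := tri_cmp0 ((tri_rot _ _ _).1 ((tri_rot _ _ _).1 t)).
rewrite cmpNl => /eqP; rewrite oppr_eq0 => /eqP/(congr1 (cmp (sh q))).
by rewrite cmp_assoc -fmap_cmp qf fmap_id cmp_idl cmp0r.
Qed.

(** The cone of the inclusion is a complement, since a split monomorphism has zero connecting
    map. *)
Lemma retract_dsum X Y : retract X Y -> exists Z, is_dsum X Z Y.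
Proof.
move=> [i [q qi]]; have [Z [g [h t]]] := tri_cone i.
by exists Z; apply: (@split_tri_dsum _ _ _ i g); rewrite -(split_mono_tri qi t).
Qed.

(** The cone of [i1] is identified with [Y]: the projection [p2] factors through it, and the
    factorization is inverse to [g \oc i2]. *)
Lemma dsum_ext X Y S : is_dsum X Y S -> ext X S Y.
Proof.
move=> [i1 [i2 [p1 [p2 [p11 p22 p12 p21 e]]]]].
have [C [g [h t]]] := tri_cone i1.
apply: ext_isor (ex_intro _ i1 (ex_intro _ g (ex_intro _ h t))).
have [w wg] := tri_exact_contra t p21.
have g_epi (u : hom C C) : u \oc g = 0 -> u = 0.
  move=> ug; have [v ->] := tri_exact_contra ((tri_rot _ _ _).1 t) ug.
  by rewrite (split_mono_tri p11 t) cmp0r.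
exists w, (g \oc i2); split; last by rewrite cmp_assoc -wg.
apply/eqP; rewrite -subr_eq0; apply/eqP/g_epi.
rewrite cmpBl cmp_idl -!cmp_assoc -wg -{2}(cmp_idr g) -cmpBr -e.
by rewrite opprD addrCA subrr addr0 cmpNr cmp_assoc (tri_cmp0 t) cmp0l oppr0.
Qed.

Lemma ext_swap A E B : (forall h : hom B (shift T A), h = 0) ->
  ext A E B -> ext B E A.
Proof.
move=> h0 [f [g [h t]]]; rewrite (h0 h) in t.
exact/dsum_ext/dsum_sym/(split_tri_dsum t).
Qed.

(* The endomorphism [c] of the middle term differs from the identity by a
   square-zero one. *)
Lemma tri_end_iso X Y Z (f : hom X Y) (g : hom Y Z) (h : hom Z (shift T X))
    (c : hom Y Y) :
  tri f g h -> c \oc f = f -> g \oc c = g -> is_iso c.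
Proof.
move=> t cf gc; have [e ec] : exists e, e = c - idm Y by exists (c - idm Y).
have [|u eu] := tri_exact_cov (u := e) t.
  by rewrite ec cmpBr gc cmp_idr subrr.
have [|w ew] := tri_exact_contra (u := e) t.
  by rewrite ec cmpBl cf cmp_idl subrr.
have ee : e \oc e = 0.
  by rewrite {1}ew eu -cmp_assoc (cmp_assoc g) (tri_cmp0 t) cmp0l cmp0r.
have ce : c = idm Y + e by rewrite ec addrC subrK.
exists (idm Y - e); rewrite ce; split.
  by rewrite cmpBl !cmpDr !cmp_idl !cmp_idr ee addr0 addrK.
by rewrite cmpDl !cmpBr !cmp_idl !cmp_idr ee subr0 subrK.
Qed.

Lemma tri_fill_mid X Y Z X' Y' Z' (f : hom X Y) (g : hom Y Z)
    (h : hom Z (shift T X)) (f' : hom X' Y') (g' : hom Y' Z')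
    (h' : hom Z' (shift T X')) (a : hom X X') (c : hom Z Z') :
  tri f g h -> tri f' g' h' -> sh a \oc h = h' \oc c ->
  exists b : hom Y Y', b \oc f = f' \oc a /\ g' \oc b = c \oc g.
Proof.
move=> t t' e.
have t1 := (tri_rot _ _ _).1 ((tri_rot _ _ _).1 t).
have t1' := (tri_rot _ _ _).1 ((tri_rot _ _ _).1 t').
have [b' [e1 e2]] := tri_fill t1 t1' e.
have [b eb] := shift_full b'; exists b; split; apply: shift_faithful.
  rewrite !fmap_cmp eb; move: e1; rewrite cmpNr cmpNl.
  by move/oppr_inj.
rewrite !fmap_cmp eb; move: e2; rewrite cmpNr cmpNl.
by move/oppr_inj.
Qed.

(** The cone of [h] is rotated back twice; the two minus signs absorb those of the rotation
    axiom. *)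
Lemma tri_of_third A B (h : hom B (shift T A)) :
  exists (E : T) (f : hom A E) (g : hom E B), tri f g h.
Proof.
have [V [u [w t]]] := tri_cone h.
have [e [e' [e1 e2]]] := unshiftK V.
have [f0 ef0] := shift_full (e' \oc u).
have [g0 eg0] := shift_full (w \oc e).
exists (unshift T V), (- f0), (- g0); apply/tri_rot/tri_rot.
rewrite !linearN !opprK ef0 eg0.
apply: (@tri_iso _ _ _ _ _ _ _ _ _ _ _ _ _ _ (idm _) (idm _) e' _ _ _ _ _ _ t).
- by exists (idm _); rewrite cmp_idl.
- by exists (idm _); rewrite cmp_idl.
- by exists e; split; [exact: e2|exact: e1].
- by rewrite cmp_idl cmp_idr.
- by rewrite cmp_idr.
- by rewrite fmap_id cmp_idl -cmp_assoc e2 cmp_idr.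
Qed.

(** [E'] sits over the connecting map [B' -> B -> A[1] -> A'[1]]. The composite [E -> E' -> E] is
    the identity on both ends, hence an automorphism by [tri_end_iso]; its inverse corrects the
    retraction. *)
Lemma ext_retract A E B A' B' : ext A E B -> retract A A' -> retract B B' ->
  exists2 E', ext A' E' B' & retract E E'.
Proof.
move=> [f [g [h t]]] [ia [qa qia]] [ib [qb qib]].
have [E' [f' [g' t']]] := tri_of_third (sh ia \oc h \oc qb).
exists E'; first by exists f', g', (sh ia \oc h \oc qb).
have [|b [b1 b2]] := tri_fill_mid (a := ia) (c := ib) t t'.
  by rewrite -cmp_assoc qib cmp_idr.
have [|b' [b1' b2']] := tri_fill_mid (a := qa) (c := qb) t' t.
  by rewrite !cmp_assoc -fmap_cmp qia fmap_id cmp_idl.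
have [||v [vb _]] := @tri_end_iso _ _ _ _ _ _ (b' \oc b) t.
- by rewrite -cmp_assoc b1 cmp_assoc b1' -cmp_assoc qia cmp_idr.
- by rewrite cmp_assoc b2' -cmp_assoc b2 cmp_assoc qib cmp_idl.
by exists b, (v \oc b'); rewrite -cmp_assoc.
Qed.

End Triangles.

(** * Towers and complexity *)

Section Shifts.
Variables (k : fieldType) (T : tricat k).
Implicit Types X Y A E B : T.

Lemma shiftzS n X : isomorphic (shift T (shiftz n X)) (shiftz (n + 1) X).
Proof.
case: n => [n|[|n]]; first by rewrite -PoszD addn1; apply: iso_refl.
  exact: unshiftK.
have -> : Negz n.+1 + 1 = Negz n by rewrite !NegzE -addn1 PoszD opprD addrNK.
exact: unshiftK.
Qed.

Lemma shiftzP n X : isomorphic (unshift T (shiftz n X)) (shiftz (n - 1) X).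
Proof.
have := shiftzS (n - 1) X; rewrite subrK => /(fmap_iso (unshift T))/iso_sym e.
exact: iso_trans e (shiftK _).
Qed.

Lemma shiftz_closed (P : set T) :
  (forall X, P X -> P (shift T X)) -> (forall X, P X -> P (unshift T X)) ->
  forall n X, P X -> P (shiftz n X).
Proof.
move=> PS PU [n|n] X PX; rewrite /shiftz.
  by elim: n => //= n IH; apply: PS.
by elim: n.+1 => //= m IH; apply: PU.
Qed.

Lemma exact_shift (F : functor T T) X : exact_functor F ->
  isomorphic (F (shift T X)) (shift T (F X)).
Proof. by move=> [th [th_iso _ _]]; exists (th X). Qed.

(** For negative shifts the claim is compared after one shift, which reflects isomorphism. *)
Lemma exact_shiftz (F : functor T T) n X : exact_functor F ->
  isomorphic (F (shiftz n X)) (shiftz n (F X)).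
Proof.
move=> F_ex; elim: n => [|n IH|n IH]; first exact: iso_refl.
  rewrite -addn1 PoszD; apply: iso_trans (shiftzS _ _).
  apply: iso_trans (fmap_iso F (iso_sym (shiftzS _ _))) _.
  exact: iso_trans (exact_shift _ F_ex) (fmap_iso _ IH).
rewrite -addn1 PoszD opprD; apply: iso_trans (shiftzP _ _).
apply: shift_inj_iso; apply: iso_trans (iso_sym (unshiftK _)).
apply: iso_trans IH; apply: iso_trans (iso_sym (exact_shift _ F_ex)) _.
by apply: fmap_iso; have := shiftzS (- n%:Z - 1) X; rewrite subrK.
Qed.

Lemma ext_shiftz n A E B :
  ext A E B -> ext (shiftz n A) (shiftz n E) (shiftz n B).
Proof.
move=> e; case: n => n; rewrite /shiftz; first by elim: n => //= n; apply: ext_shift.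
by elim: n.+1 => //= m; apply: ext_unshift.
Qed.

Lemma shiftz_zero n X : is_zero X -> is_zero (shiftz n X).
Proof. by apply: (@shiftz_closed (@is_zero k T)) => Y; apply: fmap_zero. Qed.

End Shifts.

(** * Iterated extensions of objects of a given class *)

Section Filtrations.
Variables (k : fieldType) (T : tricat k).
Implicit Types (C D : set T) (E A : T).

(** A recursive form of [tower], with the factors only known to lie in [C]; the last factor is
    peeled off first. *)
Fixpoint filt C p E : Prop :=
  if p is p'.+1 then exists E' A, [/\ ext E' E A, C A & filt C p' E']
  else is_zero E.

Lemma filt_iso C p E E' : isomorphic E E' -> filt C p E -> filt C p E'.
Proof.
case: p => [|p] i /=; first exact: iso_zero.
by move=> [X [A [e cA fX]]]; exists X, A; split=> //; apply: ext_isom e.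
Qed.

Lemma filt1 C A : C A -> filt C 1 A.
Proof.
move=> cA; have [N zN] := has_zero T.
by exists N, A; split=> //; apply: ext0l.
Qed.

(** The factors of [B] are moved onto [A] one at a time by [ext_assocV]. *)
Lemma filt_ext C p q A E B :
  ext A E B -> filt C p A -> filt C q B -> filt C (p + q) E.
Proof.
move=> + fA; elim: q B E => [|q IH] B E e /=.
  by rewrite addn0 => zB; apply: filt_iso fA; apply: ext_zero_iso e zB.
rewrite addnS => -[B' [Q [eB cQ fB']]].
have [X eX1 eX2] := ext_assocV e eB.
by exists X, Q; split=> //; apply: IH eX1 fB'.
Qed.

Lemma filt_map C D (f : T -> T) :
  (forall X, is_zero X -> is_zero (f X)) ->
  (forall A E B, ext A E B -> ext (f A) (f E) (f B)) ->
  (forall A, C A -> D (f A)) ->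
  forall p E, filt C p E -> filt D p (f E).
Proof.
move=> f0 fe fC; elim=> [|p IH] E /=; first exact: f0.
by move=> [E' [A [e cA /IH fE']]]; exists (f E'), (f A); split; auto.
Qed.

Lemma tower_filt C p E (A : nat -> T) :
  tower E p A -> (forall i, (i < p)%N -> C (A i)) -> filt C p E.
Proof.
elim: p E => [|p IH] E [X [X0 XE e]] cA /=; first by rewrite -XE.
exists (X p), (A p); split; [by rewrite -XE; apply: e|exact: cA|].
apply: IH => [|i ip]; last by apply: cA; apply: ltnW.
by exists X; split=> // i ip; apply: e; apply: ltnW.
Qed.

Lemma tower_cons p E E' (A : nat -> T) B : tower E p A -> ext E E' B ->
  tower E' p.+1 (fun i => if (i < p)%N then A i else B).
Proof.
move=> [X [X0 XE e]] eB; exists (fun i => if (i <= p)%N then X i else E').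
split=> //; first by rewrite ltnn.
move=> i; rewrite ltnS => ip.
suff : ext (if (i <= p)%N then X i else E') (if (i < p)%N then X i.+1 else E')
    (if (i < p)%N then A i else B) by [].
rewrite ip; case: ltnP => [ip'|pi]; first exact: e.
have -> : i = p by apply/eqP; rewrite eqn_leq ip.
by rewrite XE.
Qed.

Lemma filt_tower C p E : filt C p E ->
  exists2 A, tower E p A & forall i, (i < p)%N -> C (A i).
Proof.
elim: p E => [|p IH] E /=; first by move=> zE; exists (fun=> E) => //; exists (fun=> E).
move=> [E' [B [e cB /IH[A tA cA]]]].
exists (fun i => if (i < p)%N then A i else B); first exact: tower_cons tA e.
by move=> i _; case: ifP => // /cA.
Qed.

Lemma tower_iso E E' p (A : nat -> T) :
  isomorphic E E' -> tower E p A -> tower E' p A.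
Proof.
move=> i [X [X0 XE e]]; case: p => [|p] in XE e *.
  by exists (fun=> E'); split=> //; apply: iso_zero i _; rewrite -XE.
exists (fun j => if (j <= p)%N then X j else E'); split=> [||j jp].
- by [].
- by rewrite ltnn.
suff : ext (if (j <= p)%N then X j else E') (if (j < p)%N then X j.+1 else E')
   (A j) by [].
move: (jp); rewrite ltnS => jp'; rewrite jp'.
case: ltnP => jp''; first exact: e.
have ejp : j = p by apply/eqP; rewrite eqn_leq jp'.
by apply: ext_isom (e j jp); rewrite ejp XE.
Qed.

Lemma filt_zero C p E : (forall A, C A -> is_zero A) -> filt C p E -> is_zero E.
Proof.
move=> C0; elim: p E => //= p IH E [E' [A [e /C0 zA /IH zE']]].
by apply: iso_zero zE'; apply: ext_zero_iso e zA.
Qed.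

(* Direct summands are encoded as retracts; [retract_dsum] is the comparison. *)
Definition split_filt C p E : Prop := exists2 S, filt C p S & retract E S.

Lemma split_filt_ext C p q A E B : ext A E B ->
  split_filt C p A -> split_filt C q B -> split_filt C (p + q) E.
Proof.
move=> e [SA fA rA] [SB fB rB]; have [S eS rE] := ext_retract e rA rB.
by exists S => //; apply: filt_ext eS fA fB.
Qed.

(** Each factor is refined in turn, and the retracts met on the way are absorbed by
    [split_filt_ext]. This is the source of submultiplicativity of the complexity. *)
Lemma split_filt_bind C D p q E : (forall A, C A -> split_filt D q A) ->
  split_filt C p E -> split_filt D (p * q) E.
Proof.
move=> CD [S + rE]; suff fS : filt C p S -> split_filt D (p * q) S.
  by move=> /fS[S' fS' r]; exists S' => //; apply: retract_trans r.
elim: p S {E rE} => [|p IH] S /=.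
  by move=> zS; exists S => //; apply/iso_retract/iso_refl.
move=> [S' [A [e /CD cA /IH fS']]]; rewrite mulSn addnC.
exact: split_filt_ext e fS' cA.
Qed.

Lemma split_filt_map C D (F : functor T T) : exact_functor F ->
  (forall A, C A -> D (F A)) ->
  forall p E, split_filt C p E -> split_filt D p (F E).
Proof.
move=> F_ex FC p E [S fS r]; exists (F S); last exact: fmap_retract.
apply: filt_map fS => // [X|A X B e]; first exact: fmap_zero.
exact: ext_exact e.
Qed.

End Filtrations.

(** * Complexity with respect to a split-generator *)

Section Complexity.
Variables (k : fieldType) (T : tricat k).
Implicit Types (G E A : T).

Definition shifts G : set T := fun A => exists n, isomorphic A (shiftz n G).

Lemma G_towerP G E p : G_tower G E p <-> split_filt (shifts G) p E.
Proof.
split=> [[M [S [n [d t]]]]|[S fS r]].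
  exists S; last exact: dsum_retract d.
  by apply: tower_filt t _ => i _; exists (n i); apply: iso_refl.
have [M d] := retract_dsum r; exists M, S.
have [A [X [X0 XS e]] cA] := filt_tower fS.
(* The default 0 can only occur at indices beyond the tower. *)
pose n i := if boolp.pselect (shifts G (A i)) is left h then sval (cid h) else 0.
exists n; split=> //; exists X; split=> // i ip.
change (ext (X i) (X i.+1) (shiftz (n i) G)).
apply: ext_isor (e i ip); rewrite /n.
case: boolp.pselect => [h|]; last by case; apply: cA.
by case: cid.
Qed.

Lemma shifts_shift G A : shifts G A -> shifts G (shift T A).
Proof.
move=> [n i]; exists (n + 1); exact: iso_trans (fmap_iso _ i) (shiftzS _ _).
Qed.

Lemma shifts_unshift G A : shifts G A -> shifts G (unshift T A).
Proof.
move=> [n i]; exists (n - 1); exact: iso_trans (fmap_iso _ i) (shiftzP _ _).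
Qed.

(** The objects having some split filtration by shifts of [G] form a thick subcategory that contains
    [G]. *)
Lemma split_generator_filt G : split_generator G ->
  forall E, exists p, split_filt (shifts G) p E.
Proof.
move=> G_gen; apply: G_gen; last first.
  exists 1%N, G; last exact/iso_retract/iso_refl.
  by apply: filt1; exists 0; apply: iso_refl.
have sh X : (exists p, split_filt (shifts G) p X) ->
    exists p, split_filt (shifts G) p (shift T X).
  move=> [p [S fS r]]; exists p, (shift T S); last exact: fmap_retract.
  apply: filt_map fS => [Y|A Y B|A]; first exact: fmap_zero.
    exact: ext_shift.
  exact: shifts_shift.
split=> //.
- move=> X Y i [p [S fS r]]; exists p, S => //.
  exact: retract_trans (iso_retract (iso_sym i)) r.
- by move=> X zX; exists 0%N, X => //; apply/iso_retract/iso_refl.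
- move=> X [p [S fS r]]; exists p, (unshift T S); last exact: fmap_retract.
  apply: filt_map fS => [Y|A Y B|A]; first exact: fmap_zero.
    exact: ext_unshift.
  exact: shifts_unshift.
- move=> X Y Z f g h t /sh[p fX] [q fY]; exists (q + p)%N.
  by apply: split_filt_ext fY fX; apply: ext_rot; exists f, g, h.
- move=> X Y S /dsum_retract r [p [S' fS' r']]; exists p, S' => //.
  exact: retract_trans r'.
Qed.

(** A zero object is a retract of [G], so it can be appended as one more factor. *)
Lemma split_filtW G p q E :
  (p <= q)%N -> split_filt (shifts G) p E -> split_filt (shifts G) q E.
Proof.
move=> /subnKC <-; elim: (q - p)%N => [|n IH] fE; first by rewrite addn0.
have [N zN] := has_zero T; rewrite -addn1 addnA.
apply: (@split_filt_ext _ _ _ _ _ E _ N); [exact: ext0r|exact: IH|].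
exists G; first by apply: filt1; exists 0; apply: iso_refl.
by exists 0, 0; rewrite cmp0l; apply/esym/is_zeroP.
Qed.

Lemma complexityP G E : split_generator G ->
  [/\ (0 < complexity G E)%N, split_filt (shifts G) (complexity G E) E &
    forall q, (0 < q)%N -> split_filt (shifts G) q E -> (complexity G E <= q)%N].
Proof.
(* The length is raised by one because the minimum is taken over positive lengths. *)
move=> G_gen; have [p0 /(split_filtW (leqnSn p0)) fp0] := split_generator_filt G_gen E.
have ex : exists p, (0 < p)%N && `[< split_filt (shifts G) p E >].
  by exists p0.+1; apply/asboolP.
rewrite /complexity; case: xgetP => [p -> [p_gt0 /G_towerP fp p_min]|].
  by split=> // q q0 /G_towerP; apply: p_min.
case: (ex_minnP ex) => m /andP[m0 /asboolP/G_towerP fm] m_min /(_ m)[].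
split=> // q q0 /G_towerP fq; apply: m_min.
by rewrite q0; apply/asboolP.
Qed.

(** Applying [F^m] to a tower for [F^n G] gives factors that are shifts of [F^m G], and each of
    these is refined by shifts of [G]. *)
Lemma complexity_iterD G (F : functor T T) (m n : nat) :
  split_generator G -> exact_functor F ->
  (complexity G (iter (m + n) F G) <=
    complexity G (iter m F G) * complexity G (iter n F G))%N.
Proof.
move=> G_gen F_ex.
have [m0 fm _] := complexityP (iter m F G) G_gen.
have [n0 fn _] := complexityP (iter n F G) G_gen.
have [_ _ ->] := complexityP (iter (m + n) F G) G_gen => //.
  by rewrite muln_gt0 m0.
rewrite mulnC; apply: (@split_filt_bind _ _ (shifts (iter m F G))).
  move=> A [j i].
  have [S fS r] := fm; exists (shiftz j S); last first.
    apply: retract_trans (iso_retract i) _.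
    case: r => a [b ba]; move: {i fS}a b ba => a b ba.
    have r : retract (iter m F G) S by exists a, b.
    case: j => j; rewrite /shiftz; first by elim: j => //= j; apply: fmap_retract.
    by elim: j.+1 => //= l; apply: fmap_retract.
  apply: filt_map fS => [X|X Y Z|X]; [exact: shiftz_zero|exact: ext_shiftz|].
  by apply: shiftz_closed; [exact: shifts_shift|exact: shifts_unshift].
rewrite iterD; elim: m {m0 fm} => [|m IH] //=.
apply: split_filt_map IH => // A [j i]; exists j.
exact: iso_trans (fmap_iso _ i) (exact_shiftz _ _ F_ex).
Qed.

End Complexity.

(** * Slicings and Harder-Narasimhan filtrations *)

Section Classes.
Variables (R : realType) (k : fieldType) (T : tricat k) (L : lattice R T).
Implicit Types A E B X Y : T.

Lemma cls_ext A E B : ext A E B -> cls E = cls A + cls B.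
Proof.
move=> [f [g [h t]]]; apply/eqP; rewrite -subr_eq0 opprD addrA /cls -!raddfB /=.
rewrite -(raddf0 (\pi_(ring_quotient.Quotient.quot (@tri_rel k T))%qT)) /=.
rewrite -ring_quotient.Quotient.idealrBE subr0.
by apply/asboolP => S S0 SB St; apply: St t.
Qed.

Lemma vcl_ext A E B : ext A E B -> vcl L E = vcl L A + vcl L B.
Proof. by move=> /cls_ext e; rewrite /vcl e raddfD. Qed.

Lemma vcl_zero X : is_zero X -> vcl L X = 0.
Proof.
move=> zX; have /vcl_ext/eqP := ext0r X zX.
by rewrite -subr_eq subrr eq_sym => /eqP.
Qed.

Lemma vcl_iso X Y : isomorphic X Y -> vcl L X = vcl L Y.
Proof.
move=> i; have [N zN] := has_zero T.
by have /vcl_ext := ext_isom i (ext0r X zN); rewrite (vcl_zero zN) addr0.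
Qed.

Lemma vcl_shift X : vcl L (shift T X) = - vcl L X.
Proof.
have [N zN] := has_zero T.
have /vcl_ext := ext_rot (ext0l X zN).
have /vcl_ext := ext_rot (ext0r X zN).
rewrite (vcl_zero zN) => /esym/eqP; rewrite addrC addr_eq0 => /eqP -> _.
by [].
Qed.

Lemma vcl_unshift X : vcl L (unshift T X) = - vcl L X.
Proof. by rewrite -(vcl_iso (unshiftK X)) vcl_shift opprK. Qed.

Lemma vcl_tower E p (A : nat -> T) :
  tower E p A -> vcl L E = \sum_(i < p) vcl L (A i).
Proof.
elim: p E => [|p IH] E [X [X0 XE e]]; first by rewrite big_ord0 -XE vcl_zero.
rewrite big_ord_recr /= -(IH (X p)); last first.
  by exists X; split=> // i ip; apply: e; apply: ltnW.
by rewrite -XE; apply/vcl_ext/e.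
Qed.

End Classes.

(** * Slicings and orthogonals of slices *)

Section Slicings.
Variables (R : realType) (k : fieldType) (T : tricat k).
Implicit Types (A E B X Y : T) (J : set R).

(** The axioms on which uniqueness of Harder-Narasimhan filtrations rests. They are isolated so that
    they apply also to transported data such as [aut_act] and [C_act], which are not packaged as
    [stab]. *)
Record slicing (P : R -> set T) : Prop := Slicing {
  slicing_iso : forall phi X Y, isomorphic X Y -> P phi X -> P phi Y;
  slicing_shift : forall phi, P (phi + 1) = image_subcat (shift T) (P phi);
  slicing_hom : forall phi1 phi2 E1 E2, phi2 < phi1 ->
    P phi1 E1 -> P phi2 E2 -> forall f : hom E1 E2, f = 0
}.

Variable P : R -> set T.
Hypothesis P_sl : slicing P.

Lemma slice_shift phi X : P phi X -> P (phi + 1) (shift T X).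
Proof.
by rewrite (slicing_shift P_sl) => PX; exists X => //; apply: iso_refl.
Qed.

Lemma slice_shift_inv phi X :
  P phi X -> exists2 Y, P (phi - 1) Y & isomorphic X (shift T Y).
Proof. by rewrite -{1}(subrK 1 phi) (slicing_shift P_sl). Qed.

Lemma slice_unshift phi X : P phi X -> P (phi - 1) (unshift T X).
Proof.
move=> /slice_shift_inv[Y PY i]; apply: (slicing_iso P_sl) PY.
exact/iso_sym/(iso_trans (fmap_iso (unshift T) i))/shiftK.
Qed.

Lemma slice_shiftz n phi X : P phi X -> P (phi + n%:~R) (shiftz n X).
Proof.
move=> PX; elim: n => [|n IH|n IH]; first by rewrite addr0.
  rewrite -addn1 PoszD intrD addrA.
  exact: (slicing_iso P_sl) (shiftzS _ _) (slice_shift IH).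
rewrite -addn1 PoszD opprD intrD addrA.
exact: (slicing_iso P_sl) (shiftzP _ _) (slice_unshift IH).
Qed.

(** Conditions on phases are expressed by vanishing of maps, which makes stability under extensions
    and retracts immediate. *)
Definition lorth J : set T := fun E =>
  forall psi S, J psi -> P psi S -> forall f : hom E S, f = 0.
Definition rorth J : set T := fun E =>
  forall psi S, J psi -> P psi S -> forall f : hom S E, f = 0.

Lemma lorth_ext J A E B : ext A E B -> lorth J A -> lorth J B -> lorth J E.
Proof.
move=> [f [g [h t]]] oA oB psi S Jpsi PS u.
have [|v ->] := tri_exact_contra (u := u) t; first exact: oA PS _.
by rewrite (oB _ _ Jpsi PS v) cmp0l.
Qed.

Lemma rorth_ext J A E B : ext A E B -> rorth J A -> rorth J B -> rorth J E.
Proof.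
move=> [f [g [h t]]] oA oB psi S Jpsi PS u.
have [|v ->] := tri_exact_cov (u := u) t; first exact: oB PS _.
by rewrite (oA _ _ Jpsi PS v) cmp0r.
Qed.

Lemma lorth_retract J X Y : retract X Y -> lorth J Y -> lorth J X.
Proof.
move=> [i [q qi]] oY psi S Jpsi PS u.
by rewrite -[u]cmp_idr -qi cmp_assoc (oY _ _ Jpsi PS (u \oc q)) cmp0l.
Qed.

Lemma rorth_retract J X Y : retract X Y -> rorth J Y -> rorth J X.
Proof.
move=> [i [q qi]] oY psi S Jpsi PS u.
by rewrite -[u]cmp_idl -qi -cmp_assoc (oY _ _ Jpsi PS (i \oc u)) cmp0r.
Qed.

Lemma lorth_zero J X : is_zero X -> lorth J X.
Proof. by move=> zX psi S _ _; apply: (zX _).1. Qed.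

Lemma rorth_zero J X : is_zero X -> rorth J X.
Proof. by move=> zX psi S _ _; apply: (zX _).2. Qed.

Lemma lorth_sub J J' X : (forall x, J' x -> J x) -> lorth J X -> lorth J' X.
Proof. by move=> JJ o psi S /JJ; apply: o. Qed.

Lemma rorth_sub J J' X : (forall x, J' x -> J x) -> rorth J X -> rorth J' X.
Proof. by move=> JJ o psi S /JJ; apply: o. Qed.

Lemma lorth_shift J J' X : (forall x, J' x -> J (x - 1)) ->
  lorth J X -> lorth J' (shift T X).
Proof.
move=> JJ o psi S /JJ Jpsi /slice_shift_inv[S' PS' [a [b [ba ab]]]] f.
have [f' ef'] := shift_full (a \oc f).
by rewrite -[f]cmp_idl -ba -cmp_assoc -ef' (o _ _ Jpsi PS' f') linear0 cmp0r.
Qed.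

Lemma rorth_shift J J' X : (forall x, J' x -> J (x - 1)) ->
  rorth J X -> rorth J' (shift T X).
Proof.
move=> JJ o psi S /JJ Jpsi /slice_shift_inv[S' PS' [a [b [ba ab]]]] f.
have [f' ef'] := shift_full (f \oc b).
by rewrite -[f]cmp_idr -ba cmp_assoc -ef' (o _ _ Jpsi PS' f') linear0 cmp0l.
Qed.

Lemma lorth_unshift J J' X : (forall x, J' x -> J (x + 1)) ->
  lorth J X -> lorth J' (unshift T X).
Proof.
move=> JJ o psi S /JJ Jpsi /slice_shift PS f.
have [a [b [ba ab]]] := unshiftK X.
apply: shift_faithful; rewrite linear0 -[LHS]cmp_idr -ba cmp_assoc.
by rewrite (o _ _ Jpsi PS (_ \oc b)) cmp0l.
Qed.

Lemma rorth_unshift J J' X : (forall x, J' x -> J (x + 1)) ->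
  rorth J X -> rorth J' (unshift T X).
Proof.
move=> JJ o psi S /JJ Jpsi /slice_shift PS f.
have [a [b [ba ab]]] := unshiftK X.
apply: shift_faithful; rewrite linear0 -[LHS]cmp_idl -ba -cmp_assoc.
by rewrite (o _ _ Jpsi PS (a \oc _)) cmp0r.
Qed.

Lemma slice_lorth phi X : P phi X -> lorth [set psi | psi < phi] X.
Proof. by move=> PX psi S lt PS f; apply: (slicing_hom P_sl) lt PX PS f. Qed.

Lemma slice_rorth phi X : P phi X -> rorth [set psi | phi < psi] X.
Proof. by move=> PX psi S lt PS f; apply: (slicing_hom P_sl) lt PS PX f. Qed.

End Slicings.

(** Uniqueness of truncations: the isomorphism of the middle terms and its inverse lift to the left
    terms, and the lifts are mutually inverse because [X -> E] and [X' -> E'] are injective on the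
    relevant maps. *)
Lemma ext_left_unique (k : fieldType) (T : tricat k) (X E Y X' E' Y' : T) :
  ext X E Y -> ext X' E' Y' -> isomorphic E E' ->
  (forall f : hom X Y', f = 0) -> (forall f : hom X' Y, f = 0) ->
  (forall f : hom (shift T X) Y, f = 0) ->
  (forall f : hom (shift T X') Y', f = 0) -> isomorphic X X'.
Proof.
move=> [f [g [h t]]] [f' [g' [h' t']]] [e [e' [ee ee']]] XY' X'Y XY X'Y'.
have [a ea] := tri_exact_cov t' (XY' (g' \oc (e \oc f))).
have [b eb] := tri_exact_cov t (X'Y (g \oc (e' \oc f'))).
(* The shift of a map killed by [y] factors through a map [W[1] -> V], hence vanishes. *)
have mono W U Z V (x : hom W U) (y : hom U Z) (z : hom Z V)
    (w : hom V (shift T U)) :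
    tri y z w -> (forall c : hom (shift T W) V, c = 0) -> y \oc x = 0 -> x = 0.
  move=> tr WV yx; apply: shift_faithful; rewrite linear0.
  have [|v ->] := tri_exact_cov (u := fmap (shift T) _ _ x)
    ((tri_rot _ _ _).1 ((tri_rot _ _ _).1 tr)).
    by rewrite cmpNl -fmap_cmp yx linear0 oppr0.
  by rewrite (WV v) cmp0r.
exists a, b; split; apply/eqP; rewrite -subr_eq0; apply/eqP.
  apply: mono t XY _.
  by rewrite cmpBr cmp_idr cmp_assoc -eb -!cmp_assoc -ea !cmp_assoc ee cmp_idl subrr.
apply: mono t' X'Y' _.
by rewrite cmpBr cmp_idr cmp_assoc -ea -!cmp_assoc -eb !cmp_assoc ee' cmp_idl subrr.
Qed.

(** * Uniqueness of Harder-Narasimhan filtrations *)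

Section HarderNarasimhan.
Variables (R : realType) (k : fieldType) (T : tricat k) (L : lattice R T).
Variable s : stab_data L.
Hypothesis s_sl : slicing (slice s).
Implicit Types (A : nat -> T) (E B X Y : T) (phi : nat -> R).
Local Notation P := (slice s).

(* Like [HN_filtration], but the zero object has the empty filtration. *)
Definition HN_tower E p A phi : Prop :=
  [/\ tower E p A, forall i, (i < p)%N -> ~ is_zero (A i) /\ P (phi i) (A i)
    & forall i, (i.+1 < p)%N -> phi i.+1 < phi i].

Lemma HN_filtration_tower E p A phi :
  HN_filtration s E p A phi -> HN_tower E p A phi.
Proof. by case. Qed.

Lemma HN_tower_decr E p A phi i j :
  HN_tower E p A phi -> (i < j < p)%N -> phi j < phi i.
Proof.
move=> [_ _ decr] /andP[ij jp]; elim: j ij jp => // j IH.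
rewrite ltnS leq_eqVlt => /predU1P[->|ij] jp; first exact: decr.
by apply: lt_trans (decr _ jp) (IH ij _); apply: ltnW.
Qed.

Lemma HN_tower_last E p A phi : HN_tower E p.+1 A phi ->
  exists2 E', ext E' E (A p) & HN_tower E' p A phi.
Proof.
move=> [[X [X0 <- e]] ss decr]; exists (X p); first exact: e.
split=> [|i ip|i ip]; last by apply: decr; apply: ltnW.
  by exists X; split=> // i ip; apply: e; apply: ltnW.
by apply: ss; apply: ltnW.
Qed.

Lemma HN_tower0 E A phi : HN_tower E 0 A phi -> is_zero E.
Proof. by move=> [[X [X0 <- _]] _ _]. Qed.

Lemma HN_tower_iso E E' p A phi : isomorphic E E' ->
  HN_tower E p A phi -> HN_tower E' p A phi.
Proof.
by move=> i [t ss decr]; split=> //; apply: tower_iso i t.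
Qed.

Lemma HN_tower_lorth E p A phi (J : set R) :
  HN_tower E p A phi -> (forall i psi, (i < p)%N -> J psi -> psi < phi i) ->
  lorth P J E.
Proof.
elim: p E => [|p IH] E; first by move=> /HN_tower0 zE _; apply: lorth_zero.
move=> /[dup] -[_ ss _] /HN_tower_last[E' e t] lt.
apply: lorth_ext e _ _.
  by apply: IH t _ => i psi ip; apply: lt; apply: ltnW.
apply: lorth_sub (slice_lorth s_sl (ss p (ltnSn p)).2) => psi Jpsi.
exact: lt Jpsi.
Qed.

(** If [E -> A p] were zero, the identity of [A p] would factor through the shift of the preceding
    stage, which has no map to that phase. With [HN_tower_lorth] this makes the last phase the least
    one receiving a nonzero map from [E]. *)
Lemma HN_tower_last_nlorth E p A phi : HN_tower E p.+1 A phi ->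
  ~ lorth P [set phi p] E.
Proof.
move=> /[dup] t /[dup] -[_ ss _] /HN_tower_last[E' [f [g [h tr]]] t'] oE.
have [Ap0 PAp] := ss p (ltnSn p).
have [|v idv] := tri_exact_contra (u := idm (A p)) ((tri_rot _ _ _).1 tr).
  by rewrite cmp_idl; apply: (oE (phi p) _ erefl PAp).
case: Ap0; apply/is_zeroP; rewrite idv.
suff -> : v = 0 by rewrite cmp0l.
suff o : lorth P [set phi p] (shift T E') by exact: (o (phi p) _ erefl PAp).
apply: (@lorth_shift _ _ _ _ s_sl [set x | x < phi p]).
  by move=> x ->; rewrite /= ltrBlDr ltrDl.
apply: HN_tower_lorth t' _ => i psi ip /= /lt_trans; apply.
by apply: HN_tower_decr t _; rewrite ip ltnSn.
Qed.

(** Towers end with the last factor; reassociation splits off the first one instead. *)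
Lemma HN_tower_head E p A phi : HN_tower E p.+1 A phi ->
  exists2 E', ext (A 0%N) E E' & rorth P [set psi | phi 0%N <= psi] E'.
Proof.
elim: p E => [|p IH] E t; have [_ ss _] := t; have [E' e t'] := HN_tower_last t.
  have [N zN] := has_zero T; exists N; last exact: rorth_zero.
  have i := ext_zero_iso_r e (HN_tower0 t').
  exact: ext_isol i (ext0r E zN).
have [E'' e1 o1] := IH _ t'; have [Y eY1 eY2] := ext_assoc e1 e.
exists Y => //; apply: rorth_ext eY1 o1 _.
apply: rorth_sub (slice_rorth s_sl (ss p.+1 (ltnSn _)).2) => psi /=.
by apply: lt_le_trans; apply: HN_tower_decr t _; rewrite ltn0Sn ltnSn.
Qed.

Lemma HN_tower_head_nrorth E p A phi : HN_tower E p.+1 A phi ->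
  ~ rorth P [set phi 0%N] E.
Proof.
move=> t oE; have [_ ss _] := t; have [E' [f [g [h tr]]] o'] := HN_tower_head t.
have [A0 PA] := ss 0%N (ltn0Sn _); apply: A0; apply: shift_zero; apply/is_zeroP.
have [|v ->] := tri_exact_cov (u := idm (shift T (A 0%N)))
  ((tri_rot _ _ _).1 ((tri_rot _ _ _).1 tr)).
  by rewrite cmp_idr (oE _ _ _ PA f) // linear0 oppr0.
by rewrite (o' _ _ _ (slice_shift s_sl PA) v) ?cmp0r //= lerDl.
Qed.

Lemma HN_tower_nonzero E p A phi : HN_tower E p.+1 A phi -> ~ is_zero E.
Proof.
by move=> /HN_tower_last_nlorth n /(@lorth_zero _ _ _ (slice s) [set phi p]).
Qed.

Lemma HN_tower_unique E E' p p' A A' phi phi' : isomorphic E E' ->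
  HN_tower E p A phi -> HN_tower E' p' A' phi' ->
  p = p' /\ forall i, (i < p)%N -> phi i = phi' i /\ vcl L (A i) = vcl L (A' i).
Proof.
elim: p p' E E' => [|p IH] [|p'] E E' i t t'; first by [].
- by case: (HN_tower_nonzero t'); apply: iso_zero i (HN_tower0 t).
- by case: (HN_tower_nonzero t); apply: iso_zero (iso_sym i) (HN_tower0 t').
have le (F F' : T) (q q' : nat) (B B' : nat -> T) (psi psi' : nat -> R) :
    isomorphic F F' ->
    HN_tower F q.+1 B psi -> HN_tower F' q'.+1 B' psi' -> psi' q' <= psi q.
  move=> j u u'; rewrite leNgt; apply/negP => lt.
  apply: (HN_tower_last_nlorth u); apply: lorth_retract (iso_retract j) _.
  apply: (HN_tower_lorth u') => m x mq' /= ->; apply: lt_le_trans lt _.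
  move: mq'; rewrite ltnS leq_eqVlt => /predU1P[->|mq'] //.
  by apply: ltW; apply: (HN_tower_decr u'); rewrite mq' ltnSn.
have phE : phi p = phi' p'.
  apply/le_anti; rewrite (le _ _ _ _ _ _ _ _ i t t').
  by rewrite (le _ _ _ _ _ _ _ _ (iso_sym i) t' t).
have [_ ss _] := t; have [_ ss' _] := t'.
have [E1 e1 t1] := HN_tower_last t; have [E1' e1' t1'] := HN_tower_last t'.
have o1 : lorth P [set psi | psi <= phi p] E1.
  apply: HN_tower_lorth t1 _ => j psi jp /= /le_lt_trans; apply.
  by apply: HN_tower_decr t _; rewrite jp ltnSn.
have o1' : lorth P [set psi | psi <= phi' p'] E1'.
  apply: HN_tower_lorth t1' _ => j psi jp /= /le_lt_trans; apply.
  by apply: HN_tower_decr t' _; rewrite jp ltnSn.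
have shl X c : lorth P [set psi | psi <= c] X ->
    lorth P [set psi | psi <= c] (shift T X).
  by apply: lorth_shift => // x /=; apply: le_trans; rewrite lerBlDr lerDl.
have PA := (ss p (ltnSn p)).2; have PA' := (ss' p' (ltnSn p')).2.
have i1 : isomorphic E1 E1'.
  apply: (ext_left_unique e1 e1' i).
  - by apply: o1 PA'; rewrite /= phE.
  - by apply: o1' PA; rewrite /= phE.
  - by apply: (shl _ _ o1) PA; rewrite /=.
  - by apply: (shl _ _ o1') PA'; rewrite /=.
have [pp' IHi] := IH _ _ _ i1 t1 t1'; split=> [|j]; first by rewrite pp'.
rewrite ltnS leq_eqVlt => /predU1P[->|jp]; last exact: IHi.
rewrite {2 4}pp' -phE; split=> //.
apply: (addrI (vcl L E1)); rewrite -(vcl_ext L e1) (vcl_iso L i1) -(vcl_ext L e1').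
exact: vcl_iso.
Qed.

End HarderNarasimhan.

(** * The rank of the degree zero cohomology of a heart *)

Section Invariants.
Variables (R : realType) (k : fieldType) (T : tricat k) (L : lattice R T).
Variable s : stab_data L.
Hypothesis s_sl : slicing (slice s).
Implicit Types (E : T).

Lemma HN_filtration_iso E E' p A phi : isomorphic E E' ->
  HN_filtration s E p A phi -> HN_filtration s E' p A phi.
Proof.
by move=> i [p0 t ss d]; have [] := HN_tower_iso i (And3 t ss d).
Qed.

Lemma HN_filtration_unique E E' p p' A A' phi phi' : isomorphic E E' ->
  HN_filtration s E p A phi -> HN_filtration s E' p' A' phi' ->
  p = p' /\ forall i, (i < p)%N -> phi i = phi' i /\ vcl L (A i) = vcl L (A' i).
Proof.
move=> i /HN_filtration_tower t /HN_filtration_tower t'.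
exact: HN_tower_unique s_sl _ _ _ _ _ _ _ _ i t t'.
Qed.

Lemma phi_plusE E p A phi : HN_filtration s E p A phi -> phi_plus s E = phi 0%N.
Proof.
move=> hn; rewrite /phi_plus.
case: xgetP => [x -> [p' [A' [phi' [hn' ->]]]]|]; last first.
  by move=> /(_ (phi 0%N))[]; exists p, A, phi.
have [_ u] := HN_filtration_unique (iso_refl E) hn hn'.
by have [-> _] := u 0%N (let: And4 p0 _ _ _ := hn in p0).
Qed.

Lemma phi_minusE E p A phi : HN_filtration s E p A phi -> phi_minus s E = phi p.-1.
Proof.
move=> hn; rewrite /phi_minus.
case: xgetP => [x -> [p' [A' [phi' [hn' ->]]]]|]; last first.
  by move=> /(_ (phi p.-1))[]; exists p, A, phi.
have [<- u] := HN_filtration_unique (iso_refl E) hn hn'.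
by have [|-> _] := u p.-1; first by case: hn => p0 _ _ _; rewrite prednK.
Qed.

Lemma massE E p A phi : HN_filtration s E p A phi ->
  mass s E = \sum_(i < p) absC (charge s (vcl L (A i))).
Proof.
move=> hn; rewrite /mass; case: xgetP => [x -> [p' [A' [phi' [hn' ->]]]]|]; last first.
  by move=> /(_ (\sum_(i < p) absC (charge s (vcl L (A i)))))[]; exists p, A, phi.
have [<- u] := HN_filtration_unique (iso_refl E) hn hn'.
by apply: eq_bigr => i _; have [_ ->] := u i (ltn_ord i).
Qed.

Lemma mass_iso E E' : isomorphic E E' -> mass s E = mass s E'.
Proof.
move=> i; rewrite /mass; congr (xget _ _); apply/seteqP; split=> x /=.
  move=> [p [A [phi [hn ->]]]]; exists p, A, phi; split=> //.
  exact: HN_filtration_iso i hn.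
move=> [p [A [phi [hn ->]]]]; exists p, A, phi; split=> //.
exact: HN_filtration_iso (iso_sym i) hn.
Qed.

Lemma slice_HN_filtration phi E : slice s phi E -> ~ is_zero E ->
  HN_filtration s E 1 (fun=> E) (fun=> phi).
Proof.
move=> PE E0; have [N zN] := has_zero T.
split=> //; exists (fun i => if i is 0%N then N else E); split=> // -[|//] _.
exact: ext0l.
Qed.

End Invariants.

Section Rank.
Variables (R : realType) (k : fieldType) (T : tricat k) (L : lattice R T).
Variable s : stab_data L.
Hypothesis s_sl : slicing (slice s).
Hypothesis s_HN : forall E, ~ is_zero E -> exists p A phi, HN_filtration s E p A phi.
Implicit Types (E B X Y : T) (A : nat -> T).
Local Notation P := (slice s).

(** [gtp c] and [lep c] are the two halves P(>c) and P(<=c) of a t-structure. *)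
Definition gtp (c : R) : set T := lorth P [set x | x <= c].
Definition lep (c : R) : set T := rorth P [set x | c < x].

Lemma gtp_slice c phi X : c < phi -> P phi X -> gtp c X.
Proof.
by move=> cphi PX; apply: lorth_sub (slice_lorth s_sl PX) => x /le_lt_trans; apply.
Qed.

Lemma lep_slice c phi X : phi <= c -> P phi X -> lep c X.
Proof.
by move=> cphi PX; apply: rorth_sub (slice_rorth s_sl PX) => x; apply: le_lt_trans.
Qed.

Lemma gtpW c d X : d <= c -> gtp c X -> gtp d X.
Proof. by move=> dc; apply: lorth_sub => x /= /le_trans; apply. Qed.

Lemma lepW c d X : c <= d -> lep c X -> lep d X.
Proof. by move=> cd; apply: rorth_sub => x /=; apply: le_lt_trans. Qed.

Lemma gtp_shift c X : gtp c X -> gtp (c + 1) (shift T X).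
Proof. by apply: (lorth_shift s_sl) => x /=; rewrite lerBlDr. Qed.

Lemma lep_shift c X : lep c X -> lep (c + 1) (shift T X).
Proof. by apply: (rorth_shift s_sl) => x /=; rewrite ltrBrDr. Qed.

Lemma gtp_unshift c X : gtp (c + 1) X -> gtp c (unshift T X).
Proof. by apply: (lorth_unshift s_sl) => x /=; rewrite lerD2r. Qed.

Lemma lep_unshift c X : lep (c + 1) X -> lep c (unshift T X).
Proof. by apply: (rorth_unshift s_sl) => x /=; rewrite ltrD2r. Qed.

Lemma gtp_ext c X E Y : ext X E Y -> gtp c X -> gtp c Y -> gtp c E.
Proof. exact: lorth_ext. Qed.

Lemma lep_ext c X E Y : ext X E Y -> lep c X -> lep c Y -> lep c E.
Proof. exact: rorth_ext. Qed.

(** The tower is cut where the phases drop to [c] or below; the later factors are collected into [Y]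
    by the octahedral axiom. *)
Lemma truncation_tower c E p A phi : HN_tower s E p A phi ->
  exists X Y, [/\ ext X E Y, gtp c X & lep c Y].
Proof.
have [N zN] := has_zero T.
elim: p E => [|p IH] E t.
  have zE := HN_tower0 t; exists E, N; split; first exact: ext0r.
    exact: lorth_zero.
  exact: rorth_zero.
have [_ ss _] := t; have [E' e t'] := HN_tower_last t.
have [cp|pc] := ltP c (phi p).
  exists E, N; split; [exact: ext0r| |exact: rorth_zero].
  apply: (HN_tower_lorth s_sl t) => i psi /=; rewrite ltnS leq_eqVlt.
  move=> /predU1P[->|ip] /le_lt_trans; apply=> //.
  by apply: lt_trans cp (HN_tower_decr t _); rewrite ip ltnSn.
have [X [Y [eX gX lY]]] := IH _ t'.
have [Y' eY eE] := ext_assoc eX e.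
exists X, Y'; split=> //; apply: lep_ext eY lY _.
exact: lep_slice pc (ss p (ltnSn p)).2.
Qed.

Lemma truncation c E : exists X Y, [/\ ext X E Y, gtp c X & lep c Y].
Proof.
have [zE|/s_HN[p [A [phi /HN_filtration_tower]]]] := boolp.EM (is_zero E).
  exists E, E; split; [exact: ext0r|exact: lorth_zero|exact: rorth_zero].
exact: truncation_tower.
Qed.

(** All Harder-Narasimhan phases of [X] exceed [c], since the last one receives a nonzero map; a map
    to [Y] then dies factor by factor. *)
Lemma gtp_lep_hom c X Y : gtp c X -> lep c Y -> forall f : hom X Y, f = 0.
Proof.
move=> gX lY f.
have [zX|/s_HN[p [A [phi /HN_filtration_tower]]]] := boolp.EM (is_zero X).
  exact: (zX _).1.
move=> t; have [_ ss _] := t.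
suff gA : forall i, (i < p)%N -> c < phi i.
  elim: p X {ss} gX t f gA => [|p IH] X gX t f gA.
    by have zX := HN_tower0 t; apply: (zX _).1.
  have [_ ss _] := t; have [X' [a [b [h tr]]] t'] := HN_tower_last t.
  have gX' : gtp c X'.
    apply: (HN_tower_lorth s_sl t') => i psi ip /= /le_lt_trans; apply.
    by apply: gA; apply: ltnW.
  have [|v ->] := tri_exact_contra (u := f) tr.
    by apply: (IH X') => // i ip; apply: gA; apply: ltnW.
  by rewrite (lY _ _ (gA p (ltnSn p)) (ss p (ltnSn p)).2 v) cmp0l.
case: p t ss => // p t ss i; rewrite ltnS => ip.
have cp : c < phi p.
  rewrite ltNge; apply/negP => pc; apply: (HN_tower_last_nlorth s_sl t).
  by apply: lorth_sub gX => x /= ->.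
move: ip; rewrite leq_eqVlt => /predU1P[->//|ip].
by apply: lt_trans cp (HN_tower_decr t _); rewrite ip ltnSn.
Qed.

Variables (rk : L -> R) (t : R).
Hypothesis rkB : {morph rk : x y / x - y}.
Hypothesis rk_slice : forall phi X, t < phi <= t + 1 -> P phi X -> 0 <= rk (vcl L X).

Definition heart X := gtp t X /\ lep (t + 1) X.

Lemma rk0 : rk 0 = 0.
Proof. by have := rkB 0 0; rewrite !subrr. Qed.

Lemma rkN x : rk (- x) = - rk x.
Proof. by rewrite -sub0r rkB rk0 sub0r. Qed.

Lemma rkD x y : rk (x + y) = rk x + rk y.
Proof. by rewrite -{1}[y]opprK rkB rkN opprK. Qed.

Lemma rk_ext X E Y : ext X E Y -> rk (vcl L E) = rk (vcl L X) + rk (vcl L Y).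
Proof. by move=> /vcl_ext ->; rewrite rkD. Qed.

(** The first and last phases are detected by maps, so all Harder-Narasimhan factors of a heart
    object have phases in [(t, t + 1]]. *)
Lemma rk_heart X : heart X -> 0 <= rk (vcl L X).
Proof.
move=> [gX lX].
have [/vcl_zero ->|/s_HN[p [A [phi /HN_filtration_tower]]]] := boolp.EM (is_zero X).
  by rewrite rk0.
move=> tX; have [tow ss _] := tX; rewrite (vcl_tower L tow).
rewrite (big_morph rk rkD rk0) sumr_ge0 // => i _.
apply: rk_slice (ss i (ltn_ord i)).2.
case: p => [|p] in tX tow ss i *; first by case: i.
apply/andP; split.
  rewrite ltNge; apply/negP => it; apply: (HN_tower_last_nlorth s_sl tX).
  apply: lorth_sub gX => x /= ->; apply: le_trans it.
  have := ltn_ord i; rewrite ltnS leq_eqVlt => /predU1P[->//|ip].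
  by apply/ltW/(HN_tower_decr tX); rewrite ip ltnSn.
rewrite leNgt; apply/negP => it; apply: (HN_tower_head_nrorth s_sl tX).
apply: rorth_sub lX => x /= ->; apply: lt_le_trans it _.
case: (posnP i) => [->//|i0]; apply/ltW/(HN_tower_decr tX).
by rewrite i0 ltn_ord.
Qed.

Lemma heart_retract X Y : retract X Y -> heart Y -> heart X.
Proof.
move=> r [gY lY].
by split; [apply: lorth_retract r gY|apply: rorth_retract r lY].
Qed.

Lemma rk_retract X Y : retract X Y -> heart Y -> rk (vcl L X) <= rk (vcl L Y).
Proof.
move=> /retract_dsum[Z d] hY; rewrite (rk_ext (dsum_ext d)) lerDl.
by apply: rk_heart; apply: heart_retract (dsum_retract (dsum_sym d)) hY.
Qed.

(* The degree zero cohomology of E for the t-structure of [heart] has rank at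
   most r. *)
Definition rank_le E r := exists U X H Y,
  [/\ ext U X H, ext X E Y, gtp (t + 1) U, heart H & lep t Y] /\ rk (vcl L H) <= r.

Lemma rank_le_zero E : is_zero E -> rank_le E 0.
Proof.
move=> zE; exists E, E, E, E; split; last by rewrite vcl_zero // rk0.
split; [exact: ext0r|exact: ext0r|exact: lorth_zero| |exact: rorth_zero].
by split; [exact: lorth_zero|exact: rorth_zero].
Qed.

(** [B] is absorbed into the part [Y] of phases at most [t]; the cohomology [H] is unchanged. *)
Lemma rank_le_ext_le E' E B r : rank_le E' r -> ext E' E B -> lep t B -> rank_le E r.
Proof.
move=> [U [X [H [Y [[eX eE' gU hH lY] rH]]]]] e lB.
have [Y' eY' eE] := ext_assoc eE' e.
by exists U, X, H, Y'; split=> //; split=> //; apply: lep_ext eY' lY lB.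
Qed.

(** [H] is extended by the kernel of a map out of [B] in the heart, whose rank is at most that of
    [B]. *)
Lemma rank_le_ext_heart E' E B r :
  rank_le E' r -> ext E' E B -> heart B -> rank_le E (r + rk (vcl L B)).
Proof.
move=> [U [X [H [Y [[eX eE' gU [gH lH] lY] rH]]]]] e [gB lB].
have [W eW eE] := ext_assoc eE' e.
have [XW [YW [eXW gXW lYW]]] := truncation t W.
(* [J] is the image of [B -> Y[1]] in the heart, and [XW] is its kernel. *)
have [J eJ eB] := ext_assoc eXW (ext_rot eW).
have hJ : heart J; first split.
- apply: gtp_ext (ext_rot eB) gB _.
  by apply: gtpW (gtp_shift gXW); rewrite lerDl.
- apply: lep_ext eJ _ (lep_shift lY).
  by apply: lepW lYW; rewrite lerDl.
have lXW : lep (t + 1) XW.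
  apply: lep_ext (ext_rot_unshift eXW) _ _.
    by apply: lep_unshift; apply: lepW lYW; lra.
  apply: lep_ext eW _ lB.
  by apply: lepW lY; lra.
have [X' eX' eE2] := ext_assocV eE eXW.
have [H' eH' eX2] := ext_assoc eX eX'.
exists U, X', H', YW; split.
  split=> //; split; first exact: gtp_ext eH' gH gXW.
  exact: lep_ext eH' lH lXW.
rewrite (rk_ext eH') lerD //.
by rewrite (rk_ext eB) lerDl; apply: rk_heart.
Qed.

(** As there is no map [B -> Y[1]], [B] can be attached to [X] before [Y]. It then replaces [H] by a
    quotient in the heart. *)
Lemma rank_le_ext_gt E' E B r :
  rank_le E' r -> ext E' E B -> gtp (t + 1) B -> rank_le E r.
Proof.
move=> [U [X [H [Y [[eX eE' gU [gH lH] lY] rH]]]]] e gB.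
have [W eW eE] := ext_assoc eE' e.
have {}eW : ext B W Y by apply: ext_swap eW; apply: gtp_lep_hom gB (lep_shift lY).
have [X' eX' eE2] := ext_assocV eE eW.
have [V eV eX2] := ext_assoc eX eX'.
have [U2 [H2 [eV2 gU2 lH2]]] := truncation (t + 1) V.
have [U' eU' eX'2] := ext_assocV eX2 eV2.
(* [J[-1]] is the kernel of the epimorphism [H -> H2] in the heart. *)
have [J eJ eH2] := ext_assoc eV (ext_rot eV2).
have gJ : gtp (t + 1) J.
  apply: gtp_ext eJ gB _.
  by apply: gtpW (gtp_shift gU2); lra.
have lJ : lep (t + 1 + 1) J.
  apply: lep_ext (ext_rot eH2) _ (lep_shift lH).
  by apply: lepW lH2; lra.
have hJ : heart (unshift T J) by split; [apply: gtp_unshift|apply: lep_unshift].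
exists U', X', H2, Y; split.
  split=> //; first exact: gtp_ext eU' gU gU2.
  split=> //; apply: gtp_ext (ext_rot eV2) _ _.
    by apply: gtp_ext eV gH _; apply: gtpW gB; lra.
  by apply: gtpW (gtp_shift gU2); lra.
have := rk_heart hJ; rewrite vcl_unshift rkN oppr_ge0 => rJ.
by rewrite (rk_ext eH2); lra.
Qed.

Lemma rank_le_ext_slice E' E B r phi : rank_le E' r -> ext E' E B -> P phi B ->
  rank_le E (r + `|rk (vcl L B)|).
Proof.
move=> rE' e PB.
have W r' r'' : r' <= r'' -> rank_le E r' -> rank_le E r''.
  move=> rr [U [X [H [Y [a b]]]]]; exists U, X, H, Y; split=> //.
  exact: le_trans b rr.
have [lt|gt] := leP phi t.
  by apply: W (rank_le_ext_le rE' e (lep_slice lt PB)); rewrite lerDl.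
have [lt1|gt1] := leP phi (t + 1).
  apply: W (rank_le_ext_heart rE' e _); first by rewrite lerD2l ler_norm.
  by split; [apply: gtp_slice gt PB|apply: lep_slice lt1 PB].
by apply: W (rank_le_ext_gt rE' e (gtp_slice gt1 PB)); rewrite lerDl.
Qed.

Lemma rank_le_ext_tower E' E B r p (A : nat -> T) : rank_le E' r -> ext E' E B ->
  tower B p A -> (forall i, (i < p)%N -> exists phi, P phi (A i)) ->
  rank_le E (r + \sum_(i < p) `|rk (vcl L (A i))|).
Proof.
move=> rE'; elim: p E B => [|p IH] E B e [X [X0 XB eX]] PA.
  rewrite big_ord0 addr0; apply: rank_le_ext_le rE' e _.
  by rewrite -XB; apply: rorth_zero.
have eB : ext (X p) B (A p) by rewrite -XB; apply: eX.
have [E1 e1 e2] := ext_assocV e eB.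
have [phi PAp] := PA p (ltnSn p).
rewrite big_ord_recr /= addrA; apply: rank_le_ext_slice e2 PAp.
apply: IH e1 _ _ => [|i ip]; last by apply: PA; apply: ltnW.
by exists X; split=> // i ip; apply: eX; apply: ltnW.
Qed.

Lemma rank_le_filt (C : set T) (c : R) p E :
  (forall B, C B -> exists q A, [/\ tower B q A,
    forall i, (i < q)%N -> exists phi, P phi (A i) &
    \sum_(i < q) `|rk (vcl L (A i))| = c]) ->
  filt C p E -> rank_le E (c *+ p).
Proof.
move=> hC; elim: p E => [|p IH] E /=; first exact: rank_le_zero.
move=> [E' [B [e /hC[q [A [tB PA sumA]]] /IH rE']]].
rewrite mulrSr -{2}sumA; exact: rank_le_ext_tower rE' e tB PA.
Qed.

(** The truncation [X1] of [E1] at [t] lies in the heart and contains [A 0] with quotient [X2] in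
    the heart. The retraction of [E] onto [E1] makes [X1] a retract of [H]. *)
Lemma rank_le_retract E E1 r p A phi : rank_le E r -> retract E1 E ->
  HN_filtration s E1 p A phi -> t < phi 0%N <= t + 1 -> rk (vcl L (A 0%N)) <= r.
Proof.
move=> [U [X [H [Y [[eX eE gU hH lY] rH]]]]] [i [q qi]] hn /andP[tphi phit].
have [p0 _ _ _] := hn; have tow := HN_filtration_tower hn.
case: p p0 {hn} tow => // p _ tow; have [_ ss _] := tow.
have PA := (ss 0%N (ltn0Sn p)).2.
have [E2 eE2 oE2] := HN_tower_head s_sl tow.
have lE2 : lep (t + 1) E2.
  by apply: rorth_sub oE2 => x /= /ltW; apply: le_trans.
have [X2 [Y1 [eE2' gX2 lY1]]] := truncation t E2.
have [X1 eX1 eE1] := ext_assocV eE2 eE2'.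
have lX2 : lep (t + 1) X2.
  apply: lep_ext (ext_rot_unshift eE2') _ lE2.
  by apply: lep_unshift; apply: lepW lY1; lra.
have hX1 : heart X1; first split.
- exact: gtp_ext eX1 (gtp_slice tphi PA) gX2.
- exact: lep_ext eX1 (lep_slice phit PA) lX2.
apply: (le_trans _ rH); apply: (@le_trans _ _ (rk (vcl L X1))).
  by rewrite (rk_ext eX1) lerDl; apply: rk_heart.
apply: (rk_retract _ hH).
have [f [g [h tr]]] := eE; have [f1 [g1 [h1 tr1]]] := eE1; have [a [b [c tr2]]] := eX.
have [gX1 lX1] := hX1.
have gX : gtp t X.
  apply: gtp_ext eX _ hH.1.
  by apply: gtpW gU; lra.
(* [i] and [q] restrict to the truncations, and the restriction of [q] kills [U], whose phases
   exceed those of [X1]. *)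
have [i' ei'] := tri_exact_cov tr (gtp_lep_hom gX1 lY (g \oc (i \oc f1))).
have [q' eq'] := tri_exact_cov tr1 (gtp_lep_hom gX lY1 (g1 \oc (q \oc f))).
have [q'' eq''] := tri_exact_contra tr2 (gtp_lep_hom gU lX1 (q' \oc a)).
exists (b \oc i'), q''.
(* The composite is the identity after the map [X1 -> E1], which is injective on maps from [X1]
   because [X1[1]] has no map to [Y1]. *)
rewrite cmp_assoc -eq''; apply/eqP; rewrite -subr_eq0; apply/eqP.
apply: shift_faithful; rewrite linear0.
have [|v ->] := tri_exact_cov (u := fmap (shift T) _ _ (q' \oc i' - idm X1))
    ((tri_rot _ _ _).1 ((tri_rot _ _ _).1 tr1)).
  rewrite cmpNl -fmap_cmp cmpBr cmp_idr cmp_assoc -eq' -cmp_assoc -ei'.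
  by rewrite cmp_assoc qi cmp_idl subrr linear0 oppr0.
have -> : v = 0.
  apply: gtp_lep_hom (gtp_shift gX1) _ v.
  by apply: lepW lY1; lra.
by rewrite cmp0r.
Qed.

End Rank.

Local Open Scope classical_set_scope.
Local Open Scope ring_scope.

(** * Real analysis *)

Section Fekete.
Variables (R : realType) (a : nat -> R).
Hypothesis a_ge0 : forall n, 0 <= a n.
Hypothesis a_sub : forall m n, a (m + n)%N <= a m + a n.

Lemma subadditive_mulD m q n : a (q * m + n)%N <= a m *+ q + a n.
Proof.
elim: q => [|q IH]; first by rewrite mulr0n add0r.
rewrite mulSn -addnA mulrS -addrA; apply: le_trans (a_sub _ _) _.
by rewrite lerD2l.
Qed.

(** Fekete's argument: divide [n] by an index whose quotient is close to the infimum; the remainder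
    contributes at most [B / n]. *)
Lemma fekete : cvgn (fun n => n%:R^-1 * a n).
Proof.
pose u n := n%:R^-1 * a n.
have u_ge0 n : 0 <= u n by rewrite mulr_ge0 // invr_ge0.
(* Index 0 is left out, since [u 0 = 0] would force the infimum to be 0. *)
pose D := [set u n.+1 | n in [set: nat]].
have D_inf : has_inf D.
  by split; [exists (u 1%N), 0%N|exists 0 => _ [n _ <-]].
apply/cvg_ex; exists (inf D); apply/cvgrPdist_le => e e0.
have e2 : 0 < e / 2 by rewrite divr_gt0.
have [_ [m _ <-] um] := inf_adherent e2 D_inf.
pose B := \sum_(i < m.+1) a i.
have aB r : (r < m.+1)%N -> a r <= B.
  move=> rm; rewrite /B (bigD1 (Ordinal rm)) //= lerDl.
  by apply: sumr_ge0.
have B0 : 0 <= B by apply: sumr_ge0.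
near=> n.
have n0 : (0 < n)%N by near: n; apply: nbhs_infty_gt.
have nR0 : 0 < n%:R :> R by rewrite ltr0n.
rewrite distrC ler_norml; apply/andP; split.
  rewrite lerBrDr addrC; apply: (@le_trans _ _ (inf D)).
    by rewrite gerDl oppr_le0 ltW.
  by apply: inf_lbound; [case: D_inf|exists n.-1; rewrite ?prednK].
rewrite -/(u n) lerBlDr; apply: (@le_trans _ _ (u m.+1 + B / n%:R)); last first.
  have -> : e + inf D = (inf D + e / 2) + e / 2 by rewrite -addrA -splitr addrC.
  apply: lerD; first exact: ltW.
  rewrite ler_pdivrMr // mulrC -ler_pdivrMr //.
  by near: n; apply: nbhs_infty_ger.
rewrite /u mulrC ler_pdivrMr // mulrDl divfK ?gt_eqF //.
rewrite {1}(divn_eq n m.+1); apply: le_trans (subadditive_mulD _ _ _) _.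
apply: lerD; last by apply: aB; rewrite ltn_mod.
rewrite -[leLHS]mulr_natl mulrAC; apply: ler_wpM2r => //.
rewrite mulrC ler_pdivlMr ?ltr0n // -natrM ler_nat.
exact: leq_trunc_div.
Unshelve. all: by end_near.
Qed.

Lemma fekete_ge (l c : R) : (forall n, l * n%:R + c <= a n) ->
  l <= limn (fun n => n%:R^-1 * a n).
Proof.
move=> la; apply/ler_addgt0Pr => e e0; rewrite -lerBlDr.
apply: limr_ge; first exact: fekete.
near=> n.
have n0 : (0 < n)%N by near: n; apply: nbhs_infty_gt.
have nR0 : 0 < n%:R :> R by rewrite ltr0n.
rewrite mulrC ler_pdivlMr // mulrBl; apply: le_trans (la n).
rewrite lerD2l lerNl mulrC -ler_pdivrMr //.
by near: n; apply: nbhs_infty_ger.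
Unshelve. all: by end_near.
Qed.

End Fekete.

(** * Comparison of an arbitrary norm with the maximum norm *)

Section Norms.
Variables (R : realType) (n : nat) (nu : 'rV[R]_n -> R).
Hypothesis nu_eq0 : forall x, nu x = 0 -> x = 0.
Hypothesis nuD : forall x y, nu (x + y) <= nu x + nu y.
Hypothesis nuZ : forall (a : R) x, nu (a *: x) = `|a| * nu x.

Lemma seminorm0 : nu 0 = 0.
Proof. by rewrite -(scale0r 0) nuZ normr0 mul0r. Qed.

Lemma seminormN x : nu (- x) = nu x.
Proof. by rewrite -scaleN1r nuZ normrN1 mul1r. Qed.

Lemma seminorm_ge0 x : 0 <= nu x.
Proof.
have := nuD x (- x); rewrite subrr seminorm0 seminormN -mulr2n.
by rewrite pmulrn_lge0.
Qed.

Lemma seminorm_le : exists2 K : R, 0 < K & forall x, nu x <= K * `|x|.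
Proof.
(* The summand 1 keeps the constant positive in rank 0. *)
exists (1 + \sum_(i < n) nu (delta_mx 0 i)).
  by rewrite ltr_wpDr // sumr_ge0 // => i _; apply: seminorm_ge0.
move=> x; rewrite {1}(row_sum_delta x).
apply: (@le_trans _ _ (\sum_(i < n) nu (x 0 i *: delta_mx 0 i))).
  elim/big_ind2: _ => [|y1 r1 y2 r2 h1 h2|//]; first by rewrite seminorm0.
  exact: le_trans (nuD _ _) (lerD h1 h2).
rewrite mulrDl mul1r.
apply: (@le_trans _ _ ((\sum_(i < n) nu (delta_mx 0 i)) * `|x|)).
  2: by rewrite lerDr.
rewrite mulr_suml; apply: ler_sum => i _.
rewrite nuZ mulrC; apply: ler_wpM2l; first exact: seminorm_ge0.
rewrite [leRHS]/Num.norm /= mx_normrE.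
by apply: (le_bigmax _ (fun j : 'I_1 * 'I_n => `|x j.1 j.2|) (0, i)).
Qed.

Lemma seminorm_continuous : continuous nu.
Proof.
have [K K0 nuK] := seminorm_le => x.
apply/(@cvgrPdist_le _ _ _ _ (nbhs_filter x)) => e e0.
apply/nbhs_ballP; exists (e / K); first by rewrite /= divr_gt0.
move=> y; rewrite -ball_normE /= => xy.
have d : `|nu x - nu y| <= nu (x - y).
  rewrite ler_norml; apply/andP; split.
    by rewrite lerNl opprB lerBlDr -[nu (x - y)]seminormN opprB -{1}(subrK x y) nuD.
  by rewrite lerBlDr -{1}(subrK y x) nuD.
apply: le_trans d _; apply: le_trans (nuK _) _.
by rewrite mulrC -ler_pdivlMr // ltW.
Qed.

(** [c] is the minimum of [nu] on the compact unit sphere; the sphere is empty in rank 0. *)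
Lemma norm_lower_bound : exists2 c : R, 0 < c & forall x, c * `|x| <= nu x.
Proof.
pose A := [set x : 'rV[R]_n | `|x| = 1].
have [[x0 Ax0]|/set0P/negP/negPn/eqP A0] := boolp.pselect (A !=set0); last first.
  exists 1 => // x; have [->|x0] := eqVneq x 0; first by rewrite normr0 mulr0 seminorm0.
  have : A (`|x|^-1 *: x) by rewrite /A /= normrZ normfV normr_id mulVf // normr_eq0.
  by rewrite A0.
have A_bd : bounded_set A.
  by exists 1; split=> // M M1 x xA; apply: (@le_trans _ _ 1); [rewrite -xA|exact: ltW].
have A_cl : closed A.
  have -> : A = (fun x : 'rV[R]_n => `|x|) @^-1` [set 1] by [].
  apply: closed_comp => [x _|]; last exact: closed_eq.
  exact: norm_continuous.
have A_co := bounded_closed_compact A_bd A_cl.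
have nu_co : {within A, continuous nu}.
  by apply: continuous_subspaceT; apply: seminorm_continuous.
have [c cA cmin] := EVT_min_rV (ex_intro _ x0 Ax0) A_co nu_co.
exists (nu c).
  rewrite lt_neqAle seminorm_ge0 andbT eq_sym; apply/eqP => /nu_eq0 c0.
  by move: cA; rewrite inE /A /= c0 normr0 => /esym/eqP; rewrite oner_eq0.
move=> x; have [->|xn0] := eqVneq x 0; first by rewrite normr0 mulr0 seminorm0.
have nx0 : 0 < `|x| by rewrite normr_gt0.
have := cmin (`|x|^-1 *: x); rewrite inE /A /= normrZ normfV normr_id.
rewrite mulVf ?gt_eqF // => /(_ erefl).
by rewrite nuZ normfV normr_id mulrC ler_pdivlMr.
Qed.

Lemma norm_int_lower_bound : exists2 c : R, 0 < c &
  forall x : 'rV[int]_n, x != 0 -> c <= nu (map_mx intr x).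
Proof.
have [c c0 cnu] := norm_lower_bound; exists c => // x xn0.
apply: le_trans (cnu _); rewrite ler_peMr ?(ltW c0) //.
have [j xj] : exists j, x 0 j != 0.
  apply/existsP; rewrite -negb_forall; apply: contraNN xn0 => /forallP x0.
  by apply/eqP/rowP => j; rewrite mxE; apply/eqP.
apply: (@le_trans _ _ `|(map_mx intr x : 'rV[R]_n) 0 j|).
  by rewrite mxE -intr_norm ler1z -gtz0_ge1 normr_gt0.
rewrite [leRHS]/Num.norm /= mx_normrE.
by apply: (le_bigmax _
  (fun i : 'I_1 * 'I_n => `|(map_mx intr x : 'rV[R]_n) i.1 i.2|) (0, j)).
Qed.

End Norms.

(** * Jordan's inequality and signs of the sine *)

Section Trigonometry.
Variable R : realType.
Implicit Types x y : R.

(** If the sine were below its chord at [x], the mean value theorem would give slopes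
    [cos c1 < 2 / pi < cos c2] with [c1 < c2], although the cosine decreases. *)
Lemma jordan_sin x : 0 <= x <= 1 / 2 -> 2 * x <= sin (pi * x).
Proof.
move=> /andP[x0 x1]; rewrite leNgt; apply/negP => lt.
have pi0 := pi_gt0 R.
have xp : 0 < x.
  rewrite lt_neqAle x0 andbT; apply/eqP => e.
  by move: lt; rewrite -e !mulr0 sin0 ltxx.
have xh : x < 1 / 2.
  rewrite lt_neqAle x1 andbT; apply/eqP => e.
  move: lt; rewrite e mulrA mulr1 sin_pihalf; lra.
have px0 : 0 < pi * x by apply: mulr_gt0.
have pxh : pi * x < pi / 2 by rewrite -[pi / 2]mulr1 -mulrA ltr_pM2l //; lra.
have sin_c a b : {within `[a, b], continuous (@sin R)}.
  by apply: continuous_subspaceT; apply: continuous_sin.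
have [c1 c1x e1] := MVT px0 (fun y _ => is_derive_sin y) (sin_c _ _).
have [c2 c2x e2] := MVT pxh (fun y _ => is_derive_sin y) (sin_c _ _).
move: c1x c2x; rewrite !in_itv /= => /andP[c10 c1x] /andP[c2x c2h].
have cc : cos c2 < cos c1.
  rewrite ltr_cos ?in_itv /=; first exact: lt_trans c1x c2x.
  - by apply/andP; split; lra.
  - by apply/andP; split; lra.
move: e1 e2; rewrite sin0 subr0 subr0 sin_pihalf => e1 e2.
have h1 : cos c1 * pi < 2.
  rewrite -(ltr_pM2r xp); rewrite -mulrA; lra.
have h2 : 2 < cos c2 * pi.
  have hx : 0 < 1 / 2 - x by lra.
  rewrite -(ltr_pM2r hx).
  have -> : cos c2 * pi * (1 / 2 - x) = cos c2 * (pi / 2 - pi * x) by field.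
  rewrite -e2; lra.
have : cos c2 * pi < cos c1 * pi by rewrite ltr_pM2r.
lra.
Qed.

Lemma sin_piD1 x : sin (pi * (x + 1)) = - sin (pi * x).
Proof. by rewrite mulrDr mulr1 sinDpi. Qed.

(** The sign is that of (-1)^j. It makes a coordinate of the charge nonnegative on a heart. *)
Lemma sin_pi_sign (j : int) : exists2 e : R, `|e| = 1 &
  forall x, j%:~R < x <= j%:~R + 1 -> 0 <= e * sin (pi * x).
Proof.
have pos x : 0 < x <= 1 -> 0 <= sin (pi * x).
  move=> /andP[x0 x1]; apply: sin_ge0_pi; rewrite mulr_ge0 ?pi_ge0 ?(ltW x0) //=.
  by rewrite ler_piMr ?pi_ge0.
elim: j => [|j [e e1 IH]|j [e e1 IH]].
- by exists 1; rewrite ?normr1 // => x /=; rewrite add0r mul1r; apply: pos.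
- exists (- e); rewrite ?normrN // => x; rewrite -addn1 PoszD intrD => /andP[x0 x1].
  have -> : sin (pi * x) = - sin (pi * (x - 1)) by rewrite -sin_piD1 subrK.
  rewrite mulrNN; apply: IH.
  by apply/andP; split; lra.
- exists (- e); rewrite ?normrN // => x.
  rewrite -addn1 PoszD opprD intrD => /andP[x0 x1].
  have -> : sin (pi * x) = - sin (pi * (x + 1)) by rewrite sin_piD1 opprK.
  rewrite mulrNN; apply: IH.
  by apply/andP; split; lra.
Qed.

Lemma sin_pi_eq0 x : sin (pi * x) = 0 -> exists j : int, x = j%:~R.
Proof.
move=> s0; exists (Num.floor x).
have S : forall j : int, sin (pi * (x - j%:~R)) = 0.
  elim=> [|j IH|j IH]; first by rewrite subr0.
    have := sin_piD1 (x - j.+1%:~R).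
    have -> : x - j.+1%:~R + 1 = x - j%:~R.
      by rewrite -addn1 PoszD intrD opprD addrA subrK.
    by rewrite IH => /eqP; rewrite eq_sym oppr_eq0 => /eqP.
  have -> : x - (- j.+1%:Z)%:~R = x - (- j%:Z)%:~R + 1.
    by rewrite -addn1 PoszD opprD intrD opprD addrA opprK.
  by rewrite sin_piD1 IH oppr0.
have /andP[f1 f2] := floor_itv x.
apply/eqP; rewrite eq_le f1 andbT leNgt; apply/negP => lt.
have : 0 < sin (pi * (x - (Num.floor x)%:~R)).
  apply: sin_gt0_pi; rewrite mulr_gt0 ?pi_gt0 ?subr_gt0 //=.
  by rewrite gtr_pMr ?pi_gt0 // ltrBlDl; move: f2; rewrite intrD1.
by rewrite S ltxx.
Qed.

Lemma ceil_interval x : exists j : int, j%:~R < x <= j%:~R + 1.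
Proof.
have /andP[c1 c2] := ceil_itv x; exists (Num.ceil x - 1).
by rewrite c1 intrD subrK.
Qed.

End Trigonometry.

(** * Hyperbolic elements and transport of stability conditions *)

Section Plane.
Variable R : realType.
Implicit Types (a b r x y phi : R) (z : R[i]).
Local Notation Re := complex.Re.
Local Notation Im := complex.Im.

Lemma absCE z : absC z = Num.sqrt (Re z ^+ 2 + Im z ^+ 2).
Proof. by case: z. Qed.

Lemma absC_ge0 z : 0 <= absC z.
Proof. by rewrite absCE sqrtr_ge0. Qed.

Lemma absC_ge_Re z : `|Re z| <= absC z.
Proof. by rewrite absCE -sqrtr_sqr ler_wsqrtr // lerDl sqr_ge0. Qed.

Lemma absC_ge_Im z : `|Im z| <= absC z.
Proof. by rewrite absCE -sqrtr_sqr ler_wsqrtr // lerDr sqr_ge0. Qed.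

Lemma absC_le z : absC z <= `|Re z| + `|Im z|.
Proof.
rewrite absCE -[leRHS]ger0_norm ?addr_ge0 // -sqrtr_sqr ler_wsqrtr //.
rewrite sqrrD !real_normK ?num_real // addrAC lerDl.
by rewrite mulrn_wge0 // mulr_ge0.
Qed.

Lemma absC_expC z : absC (expC z) = expR (Re z).
Proof.
by rewrite absCE /= !exprMn -mulrDr cos2Dsin2 mulr1 sqrtr_sqr ger0_norm // expR_ge0.
Qed.

Lemma absCM z z' : absC (z * z') = absC z * absC z'.
Proof. exact: ComplexField.Normc.normcM. Qed.

Lemma ReM_unit_phase a phi : Re (a%:C%C * unit_phase phi) = a * cos (pi * phi).
Proof. by rewrite /unit_phase /expC /= expR0 !mul1r mul0r subr0. Qed.

Lemma ImM_unit_phase a phi : Im (a%:C%C * unit_phase phi) = a * sin (pi * phi).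
Proof. by rewrite /unit_phase /expC /= expR0 !mul1r mul0r addr0. Qed.

Lemma absCM_unit_phase a phi : 0 <= a -> absC (a%:C%C * unit_phase phi) = a.
Proof.
move=> a0; rewrite absCE ReM_unit_phase ImM_unit_phase !exprMn -mulrDr.
by rewrite cos2Dsin2 mulr1 sqrtr_sqr ger0_norm.
Qed.

Lemma mxC_diag2 a b z : mxC (diag2 a b) z = Complex (a * Re z) (b * Im z).
Proof. by rewrite /mxC /diag2 !mxE /= !mul0r addr0 add0r. Qed.

Lemma invmx_diag2 a b : a * b = 1 -> invmx (diag2 a b) = diag2 b a.
Proof.
move=> ab.
have e : diag2 a b *m diag2 b a = 1%:M.
  apply/matrixP => i j; rewrite !mxE !big_ord_recl big_ord0 !mxE /= addr0.
  case: i => -[|[|//]] i; case: j => -[|[|//]] j /=;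
    rewrite ?mulr0 ?mul0r ?addr0 ?add0r //.
  by rewrite mulrC.
have [u _] := mulmx1_unit e.
by rewrite -[LHS]mulmx1 -e mulmxA mulVmx // mul1mx.
Qed.

Lemma absC_mxC_diag2 a b r z : `|a| <= r -> `|b| <= r ->
  absC (mxC (diag2 a b) z) <= r * absC z.
Proof.
move=> ar br; have r0 : 0 <= r by apply: le_trans ar.
rewrite mxC_diag2 !absCE /= -[r]ger0_norm // -sqrtr_sqr -sqrtrM ?sqr_ge0 //.
rewrite ler_wsqrtr // !exprMn mulrDr lerD // ler_wpM2r ?sqr_ge0 //.
  by rewrite -[leLHS]real_normK ?num_real // lerXn2r ?nnegrE.
by rewrite -[leLHS]real_normK ?num_real // lerXn2r ?nnegrE.
Qed.

Lemma ler_norm_subV r : 1 < `|r| -> `|r - r^-1| = `|r| - `|r|^-1.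
Proof.
have pos (x : R) : 1 < x -> `|x - x^-1| = x - x^-1.
  move=> x1; rewrite ger0_norm // subr_ge0 (le_trans _ (ltW x1)) //.
  by rewrite invf_le1 ?(ltW x1) // (lt_trans ltr01).
case: (ger0P r) => [_|r0]; first exact: pos.
by move=> /pos <-; rewrite -normrN invrN opprB opprK addrC.
Qed.

Section Hyperbolic.
Variables (g : gl2tilde R) (a b r : R).
Hypothesis g_diag : gl_mx g = diag2 a b.
Hypothesis ab1 : a * b = 1.
Hypothesis r1 : 1 < r.
Hypothesis ab_r : `|b - a| = r - r^-1.
Local Notation f := (gl_fun g).

Lemma gl_fun_shift_int x (n : int) : f (x + n%:~R) = f x + n%:~R.
Proof.
elim: n => [|n IH|n IH]; first by rewrite !addr0.
  by rewrite -addn1 PoszD intrD !addrA gl_shift IH.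
apply: (addIr 1); rewrite -gl_shift -addn1 PoszD opprD intrD !addrA !subrK.
exact: IH.
Qed.

Lemma gl_fun_polar x : exists c : R, [/\ 0 < c,
  a * cos (pi * x) = c * cos (pi * f x) & b * sin (pi * x) = c * sin (pi * f x)].
Proof.
have [c c0] := gl_compat g x; rewrite g_diag mxC_diag2 => e.
exists c; split=> //.
  by rewrite -[RHS]ReM_unit_phase -e /= /unit_phase /= expR0 mul1r.
by rewrite -[RHS]ImM_unit_phase -e /= /unit_phase /= expR0 mul1r.
Qed.

(** The real axis is an eigendirection. *)
Lemma gl_fun0_int : exists n : int, f 0 = n%:~R.
Proof.
have [c [c0 _]] := gl_fun_polar 0; rewrite mulr0 sin0 mulr0 => /esym/eqP.
rewrite mulf_eq0 (gt_eqF c0) /= => /eqP; exact: sin_pi_eq0.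
Qed.

Lemma cos_gl_fun0 : cos (pi * f 0) ^+ 2 = 1 /\ sin (pi * f 0) = 0.
Proof.
have [c [c0 _]] := gl_fun_polar 0; rewrite mulr0 sin0 mulr0 => /esym/eqP.
rewrite mulf_eq0 (gt_eqF c0) /= => /eqP s0; split=> //.
by have := cos2Dsin2 (pi * f 0); rewrite s0 expr0n addr0.
Qed.

Local Notation f0 x := (f x - f 0).

Lemma gl_fun_half : f0 (1 / 2) = 1 / 2.
Proof.
have [_ s0] := cos_gl_fun0.
have [c [c0 + _]] := gl_fun_polar (1 / 2).
rewrite mulrA mulr1 cos_pihalf mulr0 => /esym/eqP.
rewrite mulf_eq0 (gt_eqF c0) /= => /eqP cf.
have l0 : 0 < f0 (1 / 2) by rewrite subr_gt0 gl_incr //; lra.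
have l1 : f0 (1 / 2) < 1.
  rewrite ltrBlDl -gl_shift gl_incr //; lra.
have cf0 : cos (pi * f0 (1 / 2)) = cos (pi / 2).
  by rewrite mulrBr cosB cf s0 mul0r mulr0 addr0 cos_pihalf.
apply: (mulfI (lt0r_neq0 (pi_gt0 R))).
rewrite (mulrA pi 1) mulr1; apply: cos_inj cf0; rewrite in_itv /=.
  by rewrite mulr_ge0 ?pi_ge0 ?(ltW l0) //= ler_piMr ?pi_ge0 ?(ltW l1).
by have := pi_gt0 R; move=> ?; apply/andP; split; lra.
Qed.

(** The normalized lift is increasing and fixes 0, 1/2 and 1, so it preserves every interval between
    consecutive half-integers. *)
Lemma gl_fun_half_bound x : `|f0 x - x| <= 1 / 2.
Proof.
have incr y y' : y <= y' -> f0 y <= f0 y'.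
  by rewrite lerD2r le_eqVlt => /predU1P[->//|/(gl_incr g)/ltW].
have /andP[m1 m2] := floor_itv x; set m := Num.floor x in m1 m2.
have -> : f0 x - x = f0 (x - m%:~R) - (x - m%:~R).
  by rewrite -[in LHS](subrK m%:~R x) gl_fun_shift_int; ring.
have z0 : 0 <= x - m%:~R by rewrite subr_ge0.
have z1 : x - m%:~R <= 1 by rewrite lerBlDl ltW // -intrD1.
move: (x - m%:~R) z0 z1 => y z0 z1.
have e1 : f0 1 = 1.
  by have := gl_shift g 0; rewrite add0r => ->; rewrite addrAC subrr add0r.
have := gl_fun_half; rewrite ler_norml.
have [zh|zh] := leP y (1 / 2).
  have := incr _ _ z0; have := incr _ _ zh; rewrite subrr => h1 h2 h3.
  by apply/andP; split; lra.
have := incr _ _ z1; have := incr _ _ (ltW zh); rewrite e1 => h1 h2 h3.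
by apply/andP; split; lra.
Qed.

(** The cross product of a unit vector with its image, divided by the length [c] of the image, is
    [(b - a) S C / c] up to sign; it remains to see that [2 |S C| <= c]. *)
Lemma gl_fun_sin_bound x : `|sin (pi * (f0 x - x))| <= (r - r^-1) / 2.
Proof.
have [q1 s0] := cos_gl_fun0.
have [c [c0 e1 e2]] := gl_fun_polar x.
set C := cos (pi * x) in e1 *; set S := sin (pi * x) in e2 *.
have CS : C ^+ 2 + S ^+ 2 = 1 by apply: cos2Dsin2.
have e : sin (pi * (f0 x - x)) * c = cos (pi * f 0) * (b - a) * (S * C).
  rewrite mulrBr sinB mulrBr sinB cosB s0 !mulr0 subr0 addr0 -/C -/S.
  have -> : (sin (pi * f x) * cos (pi * f 0) * C -
      cos (pi * f x) * cos (pi * f 0) * S) * c =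
    cos (pi * f 0) * ((c * sin (pi * f x)) * C - (c * cos (pi * f x)) * S) by ring.
  by rewrite -e1 -e2; ring.
have c2 : c ^+ 2 = a ^+ 2 * C ^+ 2 + b ^+ 2 * S ^+ 2.
  rewrite -!exprMn e1 e2 !exprMn -mulrDr; rewrite -{1}[c ^+ 2]mulr1.
  by rewrite cos2Dsin2.
have q : `|cos (pi * f 0)| = 1.
  apply/eqP; rewrite -(@eqrXn2 _ 2) // ?expr1n ?real_normK ?num_real //.
  by apply/eqP.
have h2 : 2 * `|S * C| <= 1.
  have : 0 <= (`|S| - `|C|) ^+ 2 by rewrite sqr_ge0.
  rewrite sqrrB !real_normK ?num_real // normrM.
  by move: CS => CS' h; rewrite -mulr_natr in h; lra.
have h1 : 2 * `|S * C| <= c ^+ 2.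
  have : 0 <= (`|a * C| - `|b * S|) ^+ 2 by rewrite sqr_ge0.
  rewrite sqrrB !real_normK ?num_real // -mulr_natr -normrM.
  have -> : a * C * (b * S) = (a * b) * (S * C) by ring.
  rewrite ab1 mul1r c2 !exprMn => h; lra.
(* Both bounds together give [(2 |S C|)^2 <= 2 |S C| <= c^2]. *)
have h3 : 2 * `|S * C| <= c.
  rewrite -(@ler_pXn2r _ 2) // ?nnegrE ?mulr_ge0 ?(ltW c0) //.
  apply: le_trans h1; rewrite expr2 ler_piMl ?mulr_ge0 //.
rewrite -(ler_pM2r c0) -[c in leLHS]gtr0_norm // -normrM e !normrM q mul1r.
rewrite -normrM ab_r.
have d0 : 0 <= r - r^-1 by rewrite -ab_r.
rewrite -mulrA; apply: ler_wpM2l => //; lra.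
Qed.

(** If [ln r >= 1 / 2], the bound by 1/2 suffices. Otherwise Jordan's inequality bounds the
    displacement by [(r - r^-1) / 4], and [r - r^-1 <= 4 ln r] in this range. *)
Lemma gl_fun_bound : exists x0, forall x, `|f (x + x0) - x| <= ln r.
Proof.
have [n f0n] := gl_fun0_int.
exists (- n)%:~R => x; rewrite gl_fun_shift_int intrN -f0n.
have r0 : 0 < r by apply: lt_trans r1.
have [Lh|Lh] := leP (1 / 2) (ln r); first exact: le_trans (gl_fun_half_bound x) Lh.
set d := f0 x - x.
have dh := gl_fun_half_bound x; have ds := gl_fun_sin_bound x.
have {}ds : 2 * `|d| <= (r - r^-1) / 2.
  apply: le_trans ds; rewrite -/d.
  have [d0|d0] := ger0P d.
    apply: le_trans (ler_norm _); apply: jordan_sin; rewrite d0 /=.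
    by move: dh; rewrite -/d ger0_norm.
  rewrite -normrN -sinN -mulrN; apply: le_trans (ler_norm _); apply: jordan_sin.
  by rewrite oppr_ge0 (ltW d0) /=; move: dh; rewrite -/d ltr0_norm.
set L := ln r in Lh *.
have rE : r = expR L by rewrite lnK.
have L0 : 0 < L by apply: ln_gt0.
have v1 : 1 - L <= r^-1 by rewrite rE -expRN expR_ge1Dx.
have v2 : r <= (1 - L)^-1.
  rewrite -[leLHS]invrK lef_pV2 ?posrE ?invr_gt0 //; lra.
(* With [v1] and [v2] this yields [r - r^-1 <= 4 L]; it uses [L < 1 / 2]. *)
have v3 : (1 - L)^-1 <= 1 - L + 4 * L.
  rewrite -[leLHS]mul1r ler_pdivrMr; last lra.
  have : 0 <= L * (2 - 3 * L) by apply: mulr_ge0; lra.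
  move=> h; have -> : (1 - L + 4 * L) * (1 - L) = 1 + L * (2 - 3 * L) by ring.
  by rewrite lerDl.
lra.
Qed.

End Hyperbolic.
End Plane.

(** * Transport of slicings and filtrations; lower bound for charges *)

Section Transport.
Variables (R : realType) (k : fieldType) (T : tricat k).
Implicit Types (P : R -> set T) (X Y E : T).

Lemma slicing_comp P (f : R -> R) : {homo f : x y / x < y} ->
  (forall x, f (x + 1) = f x + 1) -> slicing P -> slicing (fun x => P (f x)).
Proof.
move=> f_incr f1 [P_iso P_sh P_hom]; split=> [phi X Y|phi|phi1 phi2 E1 E2 /f_incr].
- exact: P_iso.
- by rewrite f1 P_sh.
- exact: P_hom.
Qed.

(** Vanishing of maps between images follows from fullness of [F]. *)
Lemma slicing_image P (F : autoeq T) :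
  slicing P -> slicing (fun x => image_subcat F (P x)).
Proof.
move=> P_sl; have [P_iso P_sh P_hom] := P_sl; have F_ex := aeq_exact F.
split=> [phi X Y i [E PE j]|phi|phi1 phi2 E1 E2 lt].
- by exists E => //; apply: iso_trans (iso_sym i) j.
- apply/seteqP; split=> E.
    move=> [E' + i]; rewrite P_sh => -[E'' PE'' j]; exists (F E''); last first.
      apply: iso_trans i _; apply: iso_trans (fmap_iso F j) _.
      exact: exact_shift.
    by exists E'' => //; apply: iso_refl.
  move=> [E' [E'' PE'' j] i]; exists (shift T E'').
    exact: slice_shift P_sl _ _ PE''.
  apply: iso_trans i _; apply: iso_trans (fmap_iso _ j) _.
  exact/iso_sym/exact_shift.
- move=> [E1' PE1 [a [a' [aa' a'a]]]] [E2' PE2 [b [b' [bb' b'b]]]] f.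
  have [Gf qi] := aeq_equiv F.
  have [f' ef'] := full_of_qinv qi (b \oc f \oc a').
  have <- : b' \oc (b \oc f \oc a') \oc a = f.
    by rewrite !cmp_assoc bb' cmp_idl -cmp_assoc aa' cmp_idr.
  by rewrite -ef' (P_hom _ _ _ _ lt PE1 PE2 f') linear0 cmp0r cmp0l.
Qed.

Lemma autoeq_reflects_zero (F : autoeq T) X : is_zero (F X) -> is_zero X.
Proof.
have [Gf [[e [ei _]] _]] := aeq_equiv F.
move/(fmap_zero Gf); apply: iso_zero; exists (e X); exact: ei.
Qed.

Lemma autoeq_surj (F : autoeq T) :
  exists Gf : functor T T, forall X, isomorphic (F (Gf X)) X.
Proof. by have [Gf qi] := aeq_equiv F; exists Gf; apply: (qinv_iso qi).2. Qed.

Lemma tower_map (F : T -> T) E p (A : nat -> T) :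
  (forall X, is_zero X -> is_zero (F X)) ->
  (forall X Y Z : T, ext X Y Z -> ext (F X) (F Y) (F Z)) ->
  tower E p A -> tower (F E) p (F \o A).
Proof.
move=> F0 Fe [X [X0 XE e]]; exists (F \o X); split=> [||i ip].
- exact: F0.
- by rewrite /= XE.
- exact: Fe (e i ip).
Qed.

Variable L : lattice R T.
Implicit Types (s t : stab_data L).

Lemma HN_filtration_reslice s t (h : R -> R) E p A phi :
  (forall i, (i < p)%N -> slice s (phi i) (A i) -> slice t (h (phi i)) (A i)) ->
  {homo h : x y / x < y} ->
  HN_filtration s E p A phi -> HN_filtration t E p A (h \o phi).
Proof.
move=> st h_incr [p0 tow ss decr]; split=> // i ip; last exact/h_incr/decr.
by have [? ?] := ss i ip; split=> //; apply: st.
Qed.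

Lemma HN_filtration_map s t (F : autoeq T) (h : R -> R) E p A phi :
  (forall x X, slice s x X -> slice t (h x) (F X)) ->
  {homo h : x y / x < y} ->
  HN_filtration s E p A phi -> HN_filtration t (F E) p (F \o A) (h \o phi).
Proof.
move=> st h_incr [p0 tow ss decr]; split=> // [|i ip|i ip]; last exact/h_incr/decr.
  apply: tower_map tow => [X|X Y Z]; first exact: fmap_zero.
  exact: ext_exact (aeq_exact F).
by have [A0 sA] := ss i ip; split; [move/autoeq_reflects_zero|apply: st].
Qed.

Lemma stab_slicing (s : stab L) : slicing (slice s).
Proof.
have st := stabP s; split=> [phi|phi|].
- exact: (addsub_iso (stab_slice st phi)).
- exact: stab_shift.
- exact: stab_hom st.
Qed.

Lemma chargeB s : is_stability s -> {morph charge s : x y / x - y}.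
Proof. by case. Qed.

Lemma stab_charge_gt0 (s : stab L) phi E : slice s phi E -> ~ is_zero E ->
  0 < absC (charge s (vcl L E)).
Proof.
move=> sE /(stab_phase (stabP s) sE)[m m0 ->].
by rewrite absCM_unit_phase // ltW.
Qed.

Lemma mass_gt0 (s : stab L) E : ~ is_zero E -> 0 < mass s E.
Proof.
move=> /(stab_HN (stabP s))[p [A [phi hn]]]; rewrite (massE (stab_slicing s) hn).
have [p0 _ ss _] := hn; have [A0 sA] := ss 0%N p0.
rewrite (bigD1 (Ordinal p0)) //= ltr_wpDr ?(stab_charge_gt0 sA A0) //.
by apply: sumr_ge0 => i _; apply: absC_ge0.
Qed.

(** The class of a nonzero semistable object is a nonzero lattice point, so its norm is bounded
    below; the support property passes this on to the charge. *)
Lemma stab_charge_lower_bound (s : stab L) : exists2 c : R, 0 < c &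
  forall phi E, slice s phi E -> ~ is_zero E -> c <= absC (charge s (vcl L E)).
Proof.
have [c c0 cnu] := norm_int_lower_bound (@lnorm_eq0 _ _ _ L) (@lnormD _ _ _ L)
  (@lnormZ _ _ _ L).
have [C C0 supp] := stab_support (stabP s).
exists (c / C); first exact: divr_gt0.
move=> phi E sE E0; rewrite ler_pdivrMr // mulrC.
apply: le_trans (ltW (supp _ _ sE E0)); apply: cnu.
apply/eqP => v0; have := stab_charge_gt0 sE E0.
have -> : vcl L E = 0.
  by apply: (bij_inj (lcoord_bij L)); rewrite v0 raddf0.
have -> : charge s 0 = 0.
  by rewrite -[X in charge s X](subrr 0) (chargeB (stabP s)) subrr.
by rewrite absCE /= expr0n addr0 sqrtr0 ltxx.
Qed.

End Transport.

(** * Growth of masses and of the complexity *)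

Section Growth.
Variable R : realType.
Implicit Types x y c r : R.

Lemma linear_growth_le x y c : (forall n : nat, x * n%:R <= y * n%:R + c) -> x <= y.
Proof.
move=> h; rewrite leNgt; apply/negP; rewrite -subr_gt0 => xy.
have := archi_boundP (normr_ge0 (c / (x - y))); set n := Num.bound _ => lt.
have := h n; rewrite -lerBlDl -mulrBl mulrC -ler_pdivlMr // => le_n.
by have := le_lt_trans (le_trans le_n (ler_norm _)) lt; rewrite ltxx.
Qed.

Lemma ln_exp_growth c r n x : 0 < c -> 0 < r -> c * r ^+ n <= x ->
  ln r * n%:R + ln c <= ln x.
Proof.
move=> c0 r0 cx; have cr0 : 0 < c * r ^+ n by rewrite mulr_gt0 ?exprn_gt0.
rewrite mulr_natr -lnXn // addrC -lnM ?posrE ?exprn_gt0 //.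
by rewrite ler_ln ?posrE // (lt_le_trans cr0).
Qed.

Lemma exp_growth_unbounded c r x : 0 < c -> 1 < r ->
  ~ (forall n : nat, c * r ^+ n <= x).
Proof.
move=> c0 r1 h; have r0 := lt_trans ltr01 r1.
suff : ln r <= 0 by rewrite leNgt ln_gt0.
apply: (@linear_growth_le _ _ (ln x - ln c)) => n.
by rewrite mul0r add0r lerBrDr; apply: ln_exp_growth.
Qed.

End Growth.

(** * Comparison of masses on a connected component *)

Section Mass.
Variables (R : realType) (k : fieldType) (T : tricat k) (L : lattice R T).
Implicit Types (s t : stab L) (E : T).

Lemma dB_mass_le (s t : stab_data L) (d : R) : (dB s t <= d%:E)%E ->
  forall E, ~ is_zero E -> `|ln (mass s E / mass t E)| <= d.
Proof.
move=> st E E0; rewrite -lee_fin; apply: le_trans st.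
by apply: ereal_sup_ubound; exists E => //; apply: Or33.
Qed.

Definition mass_comparable s t := exists D : R,
  forall E, ~ is_zero E -> `|ln (mass s E) - ln (mass t E)| <= D.

Lemma dB_mass_comparable s t : (dB s t < 1%:E)%E -> mass_comparable s t.
Proof.
move=> /ltW/dB_mass_le h; exists 1 => E E0.
by rewrite -ln_div ?posrE ?mass_gt0 //; apply: h.
Qed.

Lemma mass_comparable_sym s t : mass_comparable s t -> mass_comparable t s.
Proof. by move=> [D h]; exists D => E /h; rewrite distrC. Qed.

Lemma mass_comparable_trans s t u :
  mass_comparable s t -> mass_comparable t u -> mass_comparable s u.
Proof.
move=> [D h] [D' h']; exists (D + D') => E E0.
rewrite -[X in `|X|](subrKA (ln (mass t E))).
exact: le_trans (ler_normD _ _) (lerD (h _ E0) (h' _ E0)).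
Qed.

(** Comparability is an equivalence relation whose classes contain unit balls, so they are open and
    closed. *)
Lemma component_mass_comparable (S : set (stab L)) s t :
  is_component S -> S s -> S t -> mass_comparable s t.
Proof.
move=> [s0 SE] Ss St.
have S_conn : connected S by rewrite SE; apply: component_connected.
pose U := [set u | mass_comparable s u].
have Uss : U s by exists 0 => E _; rewrite subrr normr0.
have U_open : open U.
  move=> u Uu; exists 1 => // u' /dB_mass_comparable.
  exact: mass_comparable_trans.
have U_closed : closed U.
  rewrite -[U]setCK; apply: open_closedC.
  move=> u nUu; exists 1 => // u' /dB_mass_comparable uu' Uu'.
  by apply: nUu; apply: mass_comparable_trans Uu' (mass_comparable_sym uu').
have SU : S `&` U = S.
  by apply: S_conn; [exists s|exists U|exists U].
by move: St; rewrite -SU => -[].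
Qed.

End Mass.

(** * A stability condition stretched by an autoequivalence *)

Section Translation.
Variables (R : realType) (k : fieldType) (T : tricat k) (L : lattice R T).
Variable alpha : autoeq T -> zaut L.
Hypothesis alpha_act : lattice_action alpha.
Variables (F : autoeq T) (s : stab L) (g : gl2tilde R).
Hypothesis act_eq : aut_act alpha F s = gl_act s g.
Variables (a b : R).
Hypothesis g_diag : gl_mx g = diag2 a b.
Hypothesis ab1 : a * b = 1.
Implicit Types (E X : T) (A : nat -> T).
Local Notation f := (gl_fun g).
Local Notation Z X := (charge s (vcl L X)).

Lemma act_slice phi : slice s (f phi) = image_subcat F (slice s phi).
Proof. by have /(congr1 (fun d => slice d phi)) := act_eq. Qed.

Lemma act_slice_image phi X : slice s phi X -> slice s (f phi) (F X).
Proof. by move=> sX; rewrite act_slice; exists X => //; apply: iso_refl. Qed.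

(** The equality of charges in [act_eq] is evaluated at the class of [F X], where [alpha F] cancels,
    and solved for the matrix. *)
Lemma act_charge X : Z (F X) = mxC (diag2 a b) (Z X).
Proof.
have /(congr1 (fun d => charge d (vcl L (F X)))) /= := act_eq.
rewrite (lact_class alpha_act) zaut_funK -(lact_class alpha_act) g_diag.
rewrite invmx_diag2 // => ->; rewrite !mxC_diag2 /= !mulrA ab1.
by rewrite [b * a]mulrC ab1 !mul1r; case: (Z _).
Qed.

Lemma HN_filtration_iter n E p A phi : HN_filtration s E p A phi ->
  HN_filtration s (iter n F E) p (fun i => iter n F (A i)) (fun i => iter n f (phi i)).
Proof.
move=> hn; elim: n => //= n IH.
exact: (HN_filtration_map act_slice_image (gl_incr g) IH).
Qed.

Section UpperBound.
Variable r : R.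
Hypothesis r1 : 1 < r.
Hypothesis ab_r : `|b - a| = r - r^-1.
Hypothesis a_r : `|a| <= r.
Hypothesis b_r : `|b| <= r.

(** After the real shift [x0], both stability conditions have the same filtrations: phases [x]
    correspond to [f (x + x0)], and charges differ by the inverse matrix and a rotation. *)
Lemma dB_bar_le : (dB_bar s (aut_act alpha F s) <= (ln r)%:E)%E.
Proof.
have [x0 hx0] := gl_fun_bound g_diag ab1 r1 ab_r.
have r0 : 0 < r := lt_trans ltr01 r1.
apply: (@le_trans _ _ (dB s (C_act (aut_act alpha F s) x0%:C%C))).
  by apply: ereal_inf_lbound; exists x0%:C%C.
have F_sl : slicing (slice (aut_act alpha F s)).
  exact/slicing_image/stab_slicing.
set t := C_act _ _.
have t_sl : slicing (slice t).
  apply: (slicing_comp (P := slice (aut_act alpha F s)) (f := fun x => x + x0)) F_sl.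
  - by move=> x y; rewrite ltrD2r.
  - by move=> x; rewrite addrAC.
(* [t] is only bare data, so its filtrations are obtained as images under [F] of filtrations for
   [s]. *)
have t_HN E : ~ is_zero E -> exists p A phi, HN_filtration t E p A phi.
  move=> E0; have [Gf FG] := autoeq_surj F.
  have GE0 : ~ is_zero (Gf E).
    by move=> zG; apply: E0; apply: iso_zero (FG E) _; apply: fmap_zero.
  have [p [A [phi hn]]] := stab_HN (stabP s) GE0.
  have hn' : HN_filtration t (F (Gf E)) p (F \o A) ((fun x => x - x0) \o phi).
    apply: (HN_filtration_map _ _ hn) => [x W sW|x y]; last by rewrite ltrD2r.
    by rewrite /t /= subrK; exists W => //; apply: iso_refl.
  by exists p, (F \o A), ((fun x => x - x0) \o phi); apply: HN_filtration_iso hn'.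
have t_charge v : absC (charge t v) = absC (mxC (diag2 b a) (charge s v)).
  have -> : charge t v =
      expC (- ('i%C * pi%:C%C * x0%:C%C)) * mxC (invmx (gl_mx g)) (charge s v).
    by rewrite /t act_eq.
  rewrite absCM absC_expC /= g_diag invmx_diag2 //.
  by rewrite !(mul0r, mulr0, mul1r, subr0, addr0, oppr0, expR0).
apply: ub_ereal_sup => d [E E0 hE].
have [p [A [phi hn]]] := t_HN E E0.
have hs : HN_filtration s E p A ((fun x => f (x + x0)) \o phi).
  apply: HN_filtration_reslice hn => [i _|x y xy].
    2: by apply: gl_incr; rewrite ltrD2r.
  by rewrite /t act_eq.
rewrite (phi_plusE t_sl hn) (phi_minusE t_sl hn) (massE t_sl hn) in hE.
have s_sl := stab_slicing s.
rewrite (phi_plusE s_sl hs) (phi_minusE s_sl hs) (massE s_sl hs) in hE.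
case: hE => ->; rewrite lee_fin; [exact: hx0|exact: hx0|].
have [p0 _ ss _] := hs.
have ms : 0 < \sum_(i < p) absC (Z (A i)) by rewrite -(massE s_sl hs) mass_gt0.
set m := \sum_(i < p) absC (Z (A i)) in ms *.
set m' := \sum_(i < p) absC (charge t _).
have mm' : m <= r * m'.
  rewrite mulr_sumr; apply: ler_sum => i _; rewrite t_charge.
  apply: le_trans (absC_mxC_diag2 _ a_r b_r).
  rewrite !mxC_diag2 /= !mulrA ab1 [b * a]mulrC ab1 !mul1r.
  by case: (Z _).
have m'm : m' <= r * m.
  rewrite mulr_sumr; apply: ler_sum => i _; rewrite t_charge.
  exact: absC_mxC_diag2.
have m'0 : 0 < m'.
  by rewrite -(pmulr_rgt0 _ r0); apply: lt_le_trans mm'.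
rewrite ln_div ?posrE // ler_norml lerBlDr -lnM ?posrE //.
rewrite lerBrDr addrC lerBlDr -lnM ?posrE //.
by rewrite !ler_ln ?posrE ?mulr_gt0 // mm' mulrC m'm.
Qed.

End UpperBound.

(** * Growth in the expanded and contracted coordinates of the charge *)

Section Coordinates.
(** [ce] is the expanded and [cc] the contracted coordinate, abstracted to treat both diagonal forms
    at once; [ce] vanishes on the phases [theta + j], [j] an integer. *)
Variables (ce cc : R[i] -> R) (theta r : R).
Hypothesis r1 : 1 < `|r|.
Hypothesis ceB : {morph ce : x y / x - y}.
Hypothesis ceM : forall z, ce (mxC (diag2 a b) z) = r * ce z.
Hypothesis ccM : forall z, cc (mxC (diag2 a b) z) = r^-1 * cc z.
Hypothesis ce_le : forall z, `|ce z| <= absC z.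
Hypothesis cc_le : forall z, `|cc z| <= absC z.
Hypothesis absC_le_ce_cc : forall z, absC z <= `|ce z| + `|cc z|.
Hypothesis ce_phase : forall m phi : R,
  ce (m%:C%C * unit_phase phi) = m * sin (pi * (phi - theta)).

Let r0 : 0 < `|r|. Proof. exact: lt_trans r1. Qed.
Let rn0 : r != 0. Proof. by rewrite -normr_gt0. Qed.

Lemma ce_iter n X : ce (Z (iter n F X)) = r ^+ n * ce (Z X).
Proof.
elim: n => [|n IH]; first by rewrite expr0 mul1r.
by rewrite iterS act_charge ceM IH exprS mulrA.
Qed.

Lemma cc_iter n X : cc (Z X) = r ^+ n * cc (Z (iter n F X)).
Proof.
elim: n => [|n IH]; first by rewrite expr0 mul1r.
by rewrite iterS act_charge ccM IH exprSr -!mulrA (mulrA r) divff // mul1r.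
Qed.

Lemma iter_nonzero n X : ~ is_zero X -> ~ is_zero (iter n F X).
Proof. by move=> X0; elim: n => //= n IH /autoeq_reflects_zero. Qed.

Lemma slice_iter n phi X : slice s phi X -> slice s (iter n f phi) (iter n F X).
Proof. by move=> sX; elim: n => //= n; apply: act_slice_image. Qed.

(** Otherwise the charges of the semistable objects [F^n X] would tend to 0, against
    [stab_charge_lower_bound]. *)
Lemma ce_neq0 phi X : slice s phi X -> ~ is_zero X -> ce (Z X) != 0.
Proof.
move=> sX X0; apply/eqP => ce0; have [c c0 cZ] := stab_charge_lower_bound s.
apply: (@exp_growth_unbounded _ c `|r| `|cc (Z X)| c0 r1) => n.
have := cZ _ _ (slice_iter n sX) (iter_nonzero (n := n) X0).
move=> /le_trans/(_ (absC_le_ce_cc _)); rewrite ce_iter ce0 mulr0 normr0 add0r.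
by move=> h; rewrite (cc_iter n X) normrM normrX mulrC ler_wpM2l // exprn_ge0.
Qed.

Lemma mass_iter_growth phi X : slice s phi X -> ~ is_zero X ->
  exists2 c : R, 0 < c & forall n, c * `|r| ^+ n <= mass s (iter n F X).
Proof.
move=> sX X0; exists `|ce (Z X)|; first by rewrite normr_gt0 (ce_neq0 sX).
move=> n; have hn := slice_HN_filtration (slice_iter n sX) (iter_nonzero (n := n) X0).
rewrite (massE (stab_slicing s) hn) big_ord_recl big_ord0 addr0.
by apply: le_trans (ce_le _); rewrite ce_iter normrM normrX mulrC.
Qed.

Lemma mass_iter_inv_growth (Gf : functor T T) phi X :
  (forall Y, isomorphic (F (Gf Y)) Y) -> slice s phi X -> ~ is_zero X ->
  exists2 c : R, 0 < c & forall n, c * `|r| ^+ n <= mass s (iter n Gf X).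
Proof.
move=> FG sX X0.
have iterFG n : isomorphic (iter n F (iter n Gf X)) X.
  elim: n => [|n IH]; first exact: iso_refl.
  have iter_iso m Y Y' : isomorphic Y Y' -> isomorphic (iter m F Y) (iter m F Y').
    by move=> i; elim: m => //= m; apply: fmap_iso.
  by rewrite iterSr [X in iter n F X]/=; apply: iso_trans IH; apply: iter_iso.
(* Pushing a filtration of [Gf^n X] forward by [F^n] gives one of [X], which has a single factor;
   hence so has [Gf^n X], namely [Y]. *)
have B n : exists2 Y, [/\ mass s (iter n Gf X) = absC (Z Y), ~ is_zero Y &
      vcl L (iter n F Y) = vcl L X]
    & exists psi, slice s psi Y.
  have E0 : ~ is_zero (iter n Gf X).
    move=> zE; apply: X0; apply: iso_zero (iterFG n) _.
    by elim: {1}n => //= m; apply: fmap_zero.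
  have [p [A [psi hn]]] := stab_HN (stabP s) E0.
  have [p1 u] := HN_filtration_unique (stab_slicing s) (iterFG n)
    (HN_filtration_iter n hn) (slice_HN_filtration sX X0).
  have [_ _ ss _] := hn; have [|A0 sA] := ss 0%N; first by rewrite p1.
  exists (A 0%N); last by exists (psi 0%N).
  split=> //; last by have [|_ ->] := u 0%N; rewrite ?p1.
  by rewrite (massE (stab_slicing s) hn) p1 big_ord_recl big_ord0 addr0.
have cc0 : cc (Z X) != 0.
  apply/eqP => cc0; have [c c0 cZ] := stab_charge_lower_bound s.
  apply: (@exp_growth_unbounded _ c `|r| `|ce (Z X)| c0 r1) => n.
  have [Y [_ Y0 vY] [psi sY]] := B n.
  have := cZ _ _ sY Y0 => /le_trans/(_ (absC_le_ce_cc _)).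
  rewrite (cc_iter n Y) vY cc0 mulr0 normr0 addr0 => h.
  by rewrite -vY ce_iter normrM normrX mulrC ler_wpM2l // exprn_ge0.
exists `|cc (Z X)|; first by rewrite normr_gt0.
move=> n; have [Y [-> _ vY] _] := B n.
by apply: le_trans (cc_le _); rewrite (cc_iter n Y) vY normrM normrX mulrC.
Qed.

Lemma vcl_shiftz m X : vcl L (shiftz m X) = vcl L X \/ vcl L (shiftz m X) = - vcl L X.
Proof.
apply: (@shiftz_closed _ _ (fun Y => vcl L Y = vcl L X \/ vcl L Y = - vcl L X)).
- by move=> Y [] e; [right|left]; rewrite vcl_shift e ?opprK.
- by move=> Y [] e; [right|left]; rewrite vcl_unshift e ?opprK.
- by left.
Qed.

Lemma charge0 : charge s 0 = 0.
Proof. by rewrite -[X in charge s X](subrr 0) (chargeB (stabP s)) subrr. Qed.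

(** The heart is chosen for each [n] so as to contain the first factor of [F^n G]. The constant does
    not depend on [n], as [rk] is [ce] up to sign for every heart used. *)
Lemma complexity_growth G : split_generator G -> ~ is_zero G ->
  exists2 c : R, 0 < c & forall n, c * `|r| ^+ n <= (complexity G (iter n F G))%:R.
Proof.
move=> G_gen G0; have s_sl := stab_slicing s.
have [p [A [phi hn]]] := stab_HN (stabP s) G0.
have [p0 tow ss _] := hn; have [A0 sA] := ss 0%N p0.
pose C0 := \sum_(i < p) `|ce (Z (A i))|.
have ceA0 : 0 < `|ce (Z (A 0%N))| by rewrite normr_gt0 (ce_neq0 sA).
have C0_gt0 : 0 < C0.
  by rewrite /C0 (bigD1 (Ordinal p0)) //= ltr_wpDr // sumr_ge0.
exists (`|ce (Z (A 0%N))| / C0); first exact: divr_gt0.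
move=> n; have hnn := HN_filtration_iter n hn.
set x := iter n f (phi 0%N).
have [j /andP[j1 j2]] := ceil_interval (x - theta).
have [e e1 e_pos] := sin_pi_sign R j.
pose t := j%:~R + theta; pose rk v := e * ce (charge s v).
have rkB : {morph rk : u v / u - v}.
  by move=> u v; rewrite /rk (chargeB (stabP s)) ceB mulrBr.
have ce0 : ce 0 = 0 by rewrite -(subrr 0) ceB subrr.
have rk_slice psi X : t < psi <= t + 1 -> slice s psi X -> 0 <= rk (vcl L X).
  move=> /andP[t1 t2] sX; have [zX|X0] := boolp.EM (is_zero X).
    by rewrite (vcl_zero L zX) /rk charge0 ce0 mulr0.
  have [m m0 eZ] := stab_phase (stabP s) sX X0.
  rewrite /rk eZ ce_phase mulrCA mulr_ge0 ?(ltW m0) //; apply: e_pos.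
  by rewrite /t in t1 t2; apply/andP; split; lra.
have rk_norm v : `|rk v| = `|ce (charge s v)| by rewrite normrM e1 mul1r.
have [_ [S fS rS] _] := complexityP (iter n F G) G_gen.
(* A shift changes charges only by a sign, so every shift of [G] contributes the same [C0]. *)
have rS' : rank_le s rk t S (C0 *+ complexity G (iter n F G)).
  apply: (rank_le_filt s_sl _ rkB rk_slice _ fS); first exact: stab_HN (stabP s).
  move=> B [m i]; exists p, (fun i => shiftz m (A i)); split.
  - apply: tower_iso (iso_sym i) _; apply: tower_map tow => [X|X Y W].
      exact: shiftz_zero.
    exact: ext_shiftz.
  - move=> l lp; exists (phi l + m%:~R); apply: (slice_shiftz s_sl).
    by have [] := ss l lp.
  - apply: eq_bigr => l _; rewrite rk_norm.
    case: (vcl_shiftz m (A l)) => -> //.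
    by rewrite -sub0r (chargeB (stabP s)) charge0 ceB ce0 sub0r normrN.
have xt : t < x <= t + 1 by rewrite /t; apply/andP; split; lra.
have := rank_le_retract s_sl (stab_HN (stabP s)) rkB rk_slice rS' rS hnn xt.
have [_ _ ssn _] := hnn; have [_ sAn] := ssn 0%N p0.
rewrite -[leLHS]ger0_norm; last exact: rk_slice xt sAn.
rewrite rk_norm ce_iter normrM normrX -[leRHS]mulr_natl => h.
by rewrite mulrAC ler_pdivrMr // mulrC.
Qed.

(** The logarithm of the complexity is nonnegative and subadditive, so the limit exists and inherits
    the exponential lower bound. *)
Lemma entropy_ge G : split_generator G -> ~ is_zero G ->
  ln `|r| <= entropy R G F.
Proof.
move=> G_gen G0; have [c c0 growth] := complexity_growth G_gen G0.
have cpx0 n : (0 < complexity G (iter n F G))%N.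
  by have [] := complexityP (iter n F G) G_gen.
apply: (@fekete_ge _ (fun n => ln ((complexity G (iter n F G))%:R : R)) _ _ _ (ln c)).
- by move=> n; apply: ln_ge0; rewrite ler1n.
- move=> m n; rewrite -lnM ?posrE ?ltr0n // -natrM.
  rewrite ler_ln ?posrE ?ltr0n ?muln_gt0 ?cpx0 // ler_nat.
  exact: complexity_iterD (aeq_exact F).
- by move=> n; apply: ln_exp_growth.
Qed.

(** One application of [F] changes the logarithm of the mass by [ln c] up to an error [d]. Growth
    along [F] gives [ln |r| <= ln c + d], growth along its inverse gives [ln |r| <= d - ln c], and
    [ln c] cancels in the sum. *)
Lemma translation_ge (t : stab L) (l : R[i]) (d : R) X phi :
  slice s phi X -> ~ is_zero X -> mass_comparable s t ->
  (dB t (C_act (aut_act alpha F t) l) <= d%:E)%E -> ln `|r| <= d.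
Proof.
move=> sX X0 [D st] /dB_mass_le hd.
pose t' := C_act (aut_act alpha F t) l.
have t'_sl : slicing (slice t').
  apply: (slicing_comp (P := fun x => image_subcat F (slice t x))
    (f := fun x => x + complex.Re l)).
  - by move=> x y; rewrite ltrD2r.
  - by move=> x; rewrite addrAC.
  - exact/slicing_image/stab_slicing.
pose c := absC (expC (- ('i%C * pi%:C%C * l))).
have c0 : 0 < c by rewrite /c absC_expC expR_gt0.
have mass_t' Y : ~ is_zero Y -> mass t' (F Y) = c * mass t Y.
  move=> Y0; have [p [A [psi hn]]] := stab_HN (stabP t) Y0.
  have hn' : HN_filtration t' (F Y) p (F \o A) ((fun x => x - complex.Re l) \o psi).
    apply: (HN_filtration_map _ _ hn) => [x W tW|x y]; last by rewrite ltrD2r.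
    by rewrite /t' /= subrK; exists W => //; apply: iso_refl.
  rewrite (massE t'_sl hn') (massE (stab_slicing t) hn) mulr_sumr.
  apply: eq_bigr => i _; rewrite /= absCM -/c.
  by rewrite (lact_class alpha_act) zaut_funK.
have step Y : ~ is_zero Y -> `|ln (mass t (F Y)) - ln c - ln (mass t Y)| <= d.
  move=> Y0; have FY0 : ~ is_zero (F Y) by move/autoeq_reflects_zero.
  have := hd _ FY0; rewrite -/t' mass_t' // ln_div ?posrE ?mulr_gt0 ?mass_gt0 //.
  by rewrite lnM ?posrE ?mass_gt0 // opprD addrA.
have up : ln `|r| <= ln c + d.
  have [c' c'0 growth] := mass_iter_growth sX X0.
  apply: (@linear_growth_le _ _ _ (D + ln (mass t X) - ln c')) => n.
  have := ln_exp_growth c'0 r0 (growth n).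
  have h : ln (mass t (iter n F X)) <= (ln c + d) * n%:R + ln (mass t X).
    elim: n => [|n IH]; first by rewrite mulr0 add0r.
    have := step _ (iter_nonzero (n := n) X0); rewrite ler_norml => /andP[_].
    rewrite iterS -[n.+1]addn1 natrD mulrDr mulr1 => ?; lra.
  have := st _ (iter_nonzero (n := n) X0); rewrite ler_norml => /andP[_] h1 h2.
  lra.
have down : ln `|r| <= d - ln c.
  have [Gf FG] := autoeq_surj F.
  have [c' c'0 growth] := mass_iter_inv_growth FG sX X0.
  have E0 n : ~ is_zero (iter n Gf X).
    elim: n => //= n IH zE; apply: IH; apply: iso_zero (FG _) _.
    exact: fmap_zero.
  apply: (@linear_growth_le _ _ _ (D + ln (mass t X) - ln c')) => n.
  have := ln_exp_growth c'0 r0 (growth n).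
  have h : ln (mass t (iter n Gf X)) <= (d - ln c) * n%:R + ln (mass t X).
    elim: n => [|n IH]; first by rewrite mulr0 add0r.
    have := step _ (E0 n.+1); rewrite iterS (mass_iso t (FG _)).
    rewrite ler_norml => /andP[+ _].
    rewrite -[n.+1]addn1 natrD mulrDr mulr1 => ?; lra.
  have := st _ (E0 n); rewrite ler_norml => /andP[_] h1 h2.
  lra.
lra.
Qed.

Lemma translation_length_bounds (S : set (stab L)) (G E : T) :
  is_component S -> S s -> split_generator G -> ~ is_zero E ->
  `|b - a| = `|r| - `|r|^-1 -> `|a| <= `|r| -> `|b| <= `|r| ->
  (translation_length S alpha F <= (entropy R G F)%:E)%E /\
  (0 < translation_length S alpha F)%E.
Proof.
move=> S_comp Ss G_gen E0 ab_r a_r b_r; split.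
  apply: (@le_trans _ _ (ln `|r|)%:E).
    apply: le_trans (dB_bar_le r1 ab_r a_r b_r).
    by apply: ereal_inf_lbound; exists s.
  (* If [G] were zero, every object would be a retract of an iterated extension of zero objects. *)
  rewrite lee_fin; apply: entropy_ge => // G0.
  have [p [E' fE' rE]] := split_generator_filt G_gen E.
  apply: E0; apply: retract_zero rE _; apply: filt_zero fE' => A [n i].
  exact: iso_zero (iso_sym i) (shiftz_zero n G0).
have [p [A [phi [p0 _ ss _]]]] := stab_HN (stabP s) E0.
have [A0 sA] := ss 0%N p0.
apply: (@lt_le_trans _ _ (ln `|r|)%:E); first by rewrite lte_fin ln_gt0.
apply: le_ereal_inf_tmp => _ [t St <-]; apply: le_ereal_inf_tmp => _ [l _ <-].
have ge := translation_ge sA A0 (component_mass_comparable S_comp Ss St).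
case e : (dB t _) => [d| |]; rewrite ?leey ?lee_fin //.
  by apply: (ge l); rewrite e.
(* The value [-oo] would allow any real [d], in particular one below [ln |r|]. *)
have := ge l (ln `|r| - 1); rewrite e leNye => /(_ isT).
by rewrite lerDl oppr_ge0 ler10.
Qed.

End Coordinates.

End Translation.

Theorem corollary4p11 (R : realType) (k : fieldType) (T : tricat k)
  (T_fin : finite_type T) (T_nz : nonzero_cat T)
  (G : T) (G_gen : split_generator G)
  (L : lattice R T)
  (alpha : autoeq T -> zaut L) (alpha_act : lattice_action alpha)
  (S : set (stab L)) (S_comp : is_component S)
  (F : autoeq T) (F_pA : pseudo_Anosov S alpha F) :
  (translation_length S alpha F <= (entropy R G F)%:E)%E /\
  (0 < translation_length S alpha F)%E.
Proof.
have [s [g [r [Ss act_eq r1 g_mx]]]] := F_pA.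
have [E E0] := T_nz.
have r_gt0 : 0 < `|r| by apply: lt_trans r1.
have rn0 : r != 0 by rewrite -normr_gt0.
have rV : `|r^-1| <= `|r|.
  by rewrite normfV (le_trans _ (ltW r1)) // invf_le1 ?ltW.
have r_sub := ler_norm_subV r1.
have ReB : {morph @complex.Re R : x y / x - y} by move=> [? ?] [? ?].
have ImB : {morph @complex.Im R : x y / x - y} by move=> [? ?] [? ?].
case: g_mx => g_diag.
  (* The imaginary part is expanded; it is a sine of the phase, so [theta = 0]. *)
  apply: (@translation_length_bounds _ _ _ _ _ alpha_act _ _ _ act_eq _ _ g_diag
    (mulVf rn0) (@complex.Im R) (@complex.Re R) 0 r r1 ImB _ _ _ _ _ _ S G E) => //.
  - by move=> z; rewrite mxC_diag2.
  - by move=> z; rewrite mxC_diag2.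
  - exact: absC_ge_Im.
  - exact: absC_ge_Re.
  - by move=> z; rewrite addrC absC_le.
  - by move=> m phi; rewrite ImM_unit_phase subr0.
(* The real part is expanded; [theta = - 1 / 2] turns the cosine into a shifted sine. *)
apply: (@translation_length_bounds _ _ _ _ _ alpha_act _ _ _ act_eq _ _ g_diag
  (mulfV rn0) (@complex.Re R) (@complex.Im R) (- (1 / 2)) r r1 ReB _ _ _ _ _ _
  S G E) => //.
- by move=> z; rewrite mxC_diag2.
- by move=> z; rewrite mxC_diag2.
- exact: absC_ge_Re.
- exact: absC_ge_Im.
- exact: absC_le.
- by move=> m phi; rewrite ReM_unit_phase opprK mulrDr mulrA mulr1 sinDpihalf.
- by rewrite distrC.
Qed.
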